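(* Let $\mathcal{F}_0$ be a saturated fusion system on a finite $p$-group $S$. For $1\le i\le m$ let $Q_i\le S$ be fully $\mathcal{F}_0$-normalised subgroups such that $Q_i\varphi\not\le Q_j$ for all $\varphi\in\operatorname{Hom}_{\mathcal{F}_0}(Q_i,S)$ and all $i\ne j$. Set $K_i:=\operatorname{Out}_{\mathcal{F}_0}(Q_i)$ and choose $\Delta_i\le\operatorname{Out}(Q_i)$ such that $K_i$ is a strongly $p$-embedded subgroup of $\Delta_i$. Let $$\mathcal{F}:=\langle\{\operatorname{Hom}_{\mathcal{F}_0}(P,S)\mid P\le S\}\cup\{\Delta_i\mid 1\le i\le m\}\rangle_S,$$ where $\Delta_i$ stands for the set of all automorphisms of $Q_i$ whose class in $\operatorname{Out}(Q_i)$ lies in $\Delta_i$. Assume that for each $1\le i\le m$: (a) $Q_i$ is $\mathcal{F}_0$-centric (hence $\mathcal{F}$-centric) and is minimal under inclusion among all $\mathcal{F}$-centric subgroups of $S$; and (b) no proper subgroup of $Q_i$ is $\mathcal{F}_0$-essential. Then $\mathcal{F}$ is saturated.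
   Context: Maps act on the right. A fusion system on a finite $p$-group $S$: category of subgroups of $S$ with $\operatorname{Hom}_S(P,Q)\subseteq\operatorname{Hom}_\mathcal{F}(P,Q)\subseteq\operatorname{Inj}(P,Q)$ and every morphism an isomorphism followed by an inclusion; $\langle\mathcal{C}\rangle_S$ is the smallest fusion system on $S$ containing the maps in $\mathcal{C}$. $P$ is fully $\mathcal{F}$-normalised if $|N_S(P)|\ge|N_S(R)|$ for all $\mathcal{F}$-conjugates $R$ of $P$. $P$ is $\mathcal{F}$-centric if $C_S(R)=Z(R)$ for all $\mathcal{F}$-conjugates $R$ of $P$. $\operatorname{Out}_\mathcal{F}(P)=\operatorname{Aut}_\mathcal{F}(P)/\operatorname{Inn}(P)$. $P$ is $\mathcal{F}$-essential if it is $\mathcal{F}$-centric and $\operatorname{Out}_\mathcal{F}(P)$ contains a strongly $p$-embedded subgroup, where $K<G$ is strongly $p$-embedded if $K$ contains a Sylow $p$-subgroup of $G$ and $K\cap K^g$ is a $p'$-group for all $g\in G\setminus K$. Saturated: every fully normalised subgroup is fully centralised ($|C_S(P)|$ maximal in its conjugacy class) and fully automised ($\operatorname{Aut}_S(P)\in\operatorname{Syl}_p(\operatorname{Aut}_\mathcal{F}(P))$), and every $\varphi\in\operatorname{Hom}_\mathcal{F}(P,S)$ with $P\varphi$ fully centralised extends to a morphism on $N_\varphi=\{g\in N_S(P)\mid\varphi^{-1}c_g\varphi\in\operatorname{Aut}_S(P\varphi)\}$. *)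

(* Defs.v *)
From HB Require Import structures.
From mathcomp Require Import all_boot all_order all_fingroup all_solvable.
From Stdlib Require Import ClassicalEpsilon.
Set Implicit Arguments. Unset Strict Implicit. Unset Printing Implicit Defensive.
Local Open Scope group_scope.

Definition pbool (P : Prop) : bool :=
  if excluded_middle_informative P then true else false.

Section Fusion.
Variable gT : finGroupType.

(* A "fusion-system-like" predicate: F P Q f  means  f (restricted to P) is in
   Hom_F(P,Q).  Maps are ordinary functions gT -> gT, only their restriction
   to P matters.  Maps act on the right: the composite "f then g" is g \o f. *)
Definition fpred := {set gT} -> {set gT} -> (gT -> gT) -> Prop.

Definition inj_hom (P Q : {set gT}) (f : gT -> gT) : Prop :=
  [/\ forall x y, x \in P -> y \in P -> f (x * y) = f x * f y,
      forall x y, x \in P -> y \in P -> f x = f y -> x = y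
    & f @: P \subset Q].

Definition fusion_system (S : {set gT}) (F : fpred) : Prop :=
  [/\
      (forall P Q f, F P Q f ->
         [/\ group_set P, group_set Q, P \subset S, Q \subset S & inj_hom P Q f]),
      (forall (P Q : {group gT}) g, P \subset S -> Q \subset S -> g \in S ->
         P :^ g \subset Q -> F P Q (fun x => x ^ g)),
      (forall P Q f f', F P Q f -> {in P, f =1 f'} -> F P Q f'),
      (forall P Q R f g, F P Q f -> F Q R g -> F P R (fun x => g (f x)))
    &
      (forall P Q f, F P Q f ->
         F P (f @: P) f /\
         exists2 g, F (f @: P) P g & forall x, x \in P -> g (f x) = x)].

Definition gen_fusion (S : {set gT}) (C : fpred) : fpred :=
  fun P Q f => forall G : fpred, fusion_system S G ->
    (forall P' Q' f', C P' Q' f' -> G P' Q' f') -> G P Q f.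

Definition Inn (P : {set gT}) : {set {perm gT}} :=
  [set a in Aut P | [exists g in P, [forall x in P, a x == x ^ g]]].

Definition AutS (S P : {set gT}) : {set {perm gT}} :=
  [set a in Aut P | [exists g in 'N_S(P), [forall x in P, a x == x ^ g]]].

Definition AutF (F : fpred) (P : {set gT}) : {set {perm gT}} :=
  [set a in Aut P | pbool (F P P (fun x => a x))].

Definition Out (P : {set gT}) : {set coset_of (Inn P)} := (Aut P / Inn P)%g.

Definition OutF (F : fpred) (P : {set gT}) : {set coset_of (Inn P)} :=
  (AutF F P / Inn P)%g.

(* F-conjugates of P are the images f @: P, f in Hom_F(P,S). *)
Definition fully_normalised (S : {set gT}) (F : fpred) (P : {set gT}) : Prop :=
  forall f, F P S f -> #|'N_S(f @: P)| <= #|'N_S(P)|.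

Definition fully_centralised (S : {set gT}) (F : fpred) (P : {set gT}) : Prop :=
  forall f, F P S f -> #|'C_S(f @: P)| <= #|'C_S(P)|.

Definition fully_automised (p : nat) (S : {set gT}) (F : fpred) (P : {set gT}) : Prop :=
  p.-Sylow(AutF F P) (AutS S P).

Definition centric (S : {set gT}) (F : fpred) (P : {set gT}) : Prop :=
  forall f, F P S f -> 'C_S(f @: P) = 'Z(f @: P).

(* N_phi = {g in N_S(P) | phi^-1 c_g phi in Aut_S(P phi)}, written out *)
Definition Nphi (S P : {set gT}) (f : gT -> gT) : {set gT} :=
  [set g in 'N_S(P) |
     [exists h in 'N_S(f @: P), [forall x in P, f (x ^ g) == f x ^ h]]].

Definition saturated (p : nat) (S : {set gT}) (F : fpred) : Prop :=
  [/\ fusion_system S F,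
      (forall P : {group gT}, P \subset S -> fully_normalised S F P ->
         fully_centralised S F P /\ fully_automised p S F P)
    & (forall (P : {group gT}) f, P \subset S -> F P S f ->
         fully_centralised S F (f @: P) ->
         exists psi, F (Nphi S P f) S psi /\ {in P, psi =1 f})].

End Fusion.

Definition strongly_p_embedded (p : nat) (T : finGroupType) (K G : {set T}) : Prop :=
  [/\ group_set K, K \proper G,
      (exists2 R : {group T}, p.-Sylow(G) R & R \subset K)
    & forall g, g \in G :\: K -> p^'.-group (K :&: K :^ g)].

Definition essential (gT : finGroupType) (p : nat) (S : {set gT}) (F : fpred gT)
    (P : {set gT}) : Prop :=
  centric S F P /\
  exists K : {group coset_of (Inn P)}, strongly_p_embedded p K (OutF F P).

Definition fus_gens (gT : finGroupType) (S : {set gT}) (F0 : fpred gT) (m : nat)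
    (Q : 'I_m -> {group gT}) (Delta : forall i : 'I_m, {group coset_of (Inn (Q i))})
    : fpred gT :=
  fun P R f =>
    (R = S /\ P \subset S /\ F0 P S f) \/
    exists i : 'I_m, [/\ P = Q i, R = Q i &
      exists2 a, a \in Aut (Q i) &
        (coset (Inn (Q i)) a \in Delta i) /\ f = (fun x => a x)].

(* Main.v *)
(* Over a saturated F0, the composites of F0-morphisms and elements of the
   Delta i simplify on F-centric subgroups: by minimality of the Q i such a
   subgroup meets Delta i only if it equals Q i, so an F-isomorphism between
   F-centric subgroups is either an F0-isomorphism or factors as
   (F0) (Delta i) (F0) through some Q i.  As Out_F0(Q i) is strongly p-embedded
   in Delta i, a morphism into Q i with N_phi larger than its domain already
   lies in F0, and Aut_S(Q i) stays Sylow; hence the saturation axioms hold on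
   F-centric subgroups.  On a subgroup P that is not F-centric, Alperin's
   argument writes every F0-isomorphism as a composite of isomorphisms extending
   to larger subgroups, unless all F0-conjugates of P are F0-essential; in the
   latter case none of them is properly contained in a Q i, by (b), and P would
   be F-centric.  It remains to see that a fusion system which is saturated on
   its centric subgroups and whose isomorphisms between non-centric subgroups
   are composites of extendable ones is saturated.  This goes by downward
   induction on |P|, following Broto, Castellana, Grodal, Levi and Oliver: for a
   fully normalised non-centric P, every F-automorphism extends to P C_S(P) > P,
   and the saturation axioms for P C_S(P), relative to the stabiliser of P,
   restrict to those for P. *)

Require Import Defs.
From HB Require Import structures.
From mathcomp Require Import all_boot all_fingroup all_solvable.
From Stdlib Require Import Classical ClassicalEpsilon.
Local Open Scope group_scope.
Set Implicit Arguments. Unset Strict Implicit. Unset Printing Implicit Defensive.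

(** * Automorphism groups and the calculus of F-isomorphisms *)

Lemma pboolP (P : Prop) : reflect P (pbool P).
Proof. by rewrite /pbool; case: excluded_middle_informative => h; constructor. Qed.

Lemma Inn_group_set (gT : finGroupType) (P : {group gT}) : group_set (Inn P).
Proof.
apply/group_setP; split=> [|a b].
  rewrite inE group1; apply/existsP; exists 1; rewrite group1.
  by apply/forall_inP=> x _; rewrite perm1 conjg1.
case/setIdP=> Aa /existsP[g /andP[Pg /forall_inP ag]].
case/setIdP=> Ab /existsP[h /andP[Ph /forall_inP bh]].
rewrite inE groupM //=; apply/existsP; exists (g * h); rewrite groupM //=.
apply/forall_inP=> x Px; rewrite permM (eqP (ag x Px)).
by rewrite (eqP (bh _ _)) ?groupJ // conjgM.
Qed.
Canonical Inn_group (gT : finGroupType) (P : {group gT}) :=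
  Group (Inn_group_set P).

Section Basics.
Variables (gT : finGroupType) (S : {group gT}).
Implicit Types (F : fpred gT) (P Q R X : {group gT}) (f g : gT -> gT).

Definition iso F (P P' : {set gT}) f : Prop := F P P' f /\ f @: P = P'.

Lemma AutS_conj_aut P : AutS S P = conj_aut P @* 'N_S(P).
Proof.
apply/setP=> a; apply/idP/idP.
  rewrite inE => /andP[Aa /existsP[g /andP[Ng /forall_inP ag]]].
  have [Sg Ng'] := setIP Ng.
  have -> : a = conj_aut P g.
    apply: (eq_Aut Aa (Aut_aut _ _)) => x Px.
    by rewrite norm_conj_autE // (eqP (ag x Px)).
  exact: mem_morphim.
case/morphimP=> g Ng' Ng ->; rewrite inE Aut_aut; apply/existsP; exists g.
by rewrite Ng; apply/forall_inP=> x Px; rewrite norm_conj_autE.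
Qed.

Lemma Inn_conj_aut P : Inn P = conj_aut P @* P.
Proof.
apply/setP=> a; apply/idP/idP.
  rewrite inE => /andP[Aa /existsP[g /andP[Pg /forall_inP ag]]].
  have Ng := subsetP (normG P) g Pg.
  have -> : a = conj_aut P g.
    apply: (eq_Aut Aa (Aut_aut _ _)) => x Px.
    by rewrite norm_conj_autE // (eqP (ag x Px)).
  exact: mem_morphim.
case/morphimP=> g Ng Pg ->; rewrite inE Aut_aut; apply/existsP; exists g.
by rewrite Pg; apply/forall_inP=> x Px; rewrite norm_conj_autE.
Qed.

Lemma Aut_mem P a x : a \in Aut P -> x \in P -> a x \in P.
Proof. by move=> Aa; apply: Aut_closed. Qed.

Lemma AutM P a : a \in Aut P -> {in P &, {morph a : x y / x * y}}.
Proof. by move=> Aa x y Px Py; rewrite -(autmE Aa) morphM. Qed.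

Lemma AutJ P a : a \in Aut P -> {in P &, {morph a : x y / x ^ y}}.
Proof. by move=> Aa x y Px Py; rewrite -(autmE Aa) morphJ. Qed.

Lemma im_Aut P a : a \in Aut P -> a @: P = P.
Proof. by move=> Aa; have := im_autm Aa; rewrite morphimEdom /= autmE. Qed.

Lemma Inn_norm P : Aut P \subset 'N(Inn P).
Proof.
rewrite Inn_conj_aut; apply/subsetP=> a Aa; rewrite inE; apply/subsetP=> b.
case/imsetP=> c /morphimP[g Ng Pg ->] ->.
have -> : conj_aut P g ^ a = conj_aut P (a g).
  apply: (@eq_Aut _ P); rewrite ?groupJ ?Aut_aut // => x Px.
  rewrite norm_conj_autE ?(subsetP (normG P)) ?Aut_mem //.
  have Vx: a^-1 x \in P by rewrite Aut_mem ?groupV.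
  rewrite conjgE !permM norm_conj_autE //.
  by rewrite (AutJ Aa) // permKV.
by rewrite mem_morphim ?(subsetP (normG P)) ?Aut_mem.
Qed.

Section System.
Variables (F : fpred gT) (FS : fusion_system S F).

Lemma FSub (P P' : {set gT}) f : F P P' f ->
  [/\ P \subset S, P' \subset S & f @: P \subset P'].
Proof. by case: FS => h _ _ _ _ /h[_ _ ? ? []]. Qed.

Lemma isoS P P' f : iso F P P' f -> P \subset S /\ P' \subset S.
Proof. by case=> /FSub[]. Qed.

Lemma FM P (P' : {set gT}) f : F P P' f -> {in P &, {morph f : x y / x * y}}.
Proof. by case: FS => h _ _ _ _ /h[_ _ _ _ [fM _ _]] x y; apply: fM. Qed.

Lemma FI P (P' : {set gT}) f : F P P' f -> {in P &, injective f}.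
Proof. by case: FS => h _ _ _ _ /h[_ _ _ _ [_ fI _]] x y; apply: fI. Qed.

Lemma F_ext (P P' : {set gT}) f g : F P P' f -> {in P, f =1 g} -> F P P' g.
Proof. by case: FS => _ _ h _ _; apply: h. Qed.

Lemma isoE P P' f g : iso F P P' f -> {in P, f =1 g} -> iso F P P' g.
Proof.
case=> Ff e efg; split; first exact: F_ext Ff efg.
by rewrite -e; symmetry; apply: eq_in_imset.
Qed.

Lemma F_incl P P' : P \subset P' -> P' \subset S -> F P P' id.
Proof.
move=> sPP' sPS; apply: (@F_ext _ _ (fun x => x ^ 1)) => [|x _]; last exact: conjg1.
by case: FS => _ h _ _ _; apply: h; rewrite ?conjsg1 ?group1 ?(subset_trans sPP').
Qed.

Lemma iso_id P : P \subset S -> iso F P P id.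
Proof. by move=> sPS; split; [exact: F_incl | exact: imset_id]. Qed.

Lemma Fcomp (P P1 P2 : {set gT}) f g : F P P1 f -> F P1 P2 g -> F P P2 (g \o f).
Proof. by case: FS => _ _ _ h _; apply: h. Qed.

Lemma iso_comp (P P1 P2 : {set gT}) f g :
  iso F P P1 f -> iso F P1 P2 g -> iso F P P2 (g \o f).
Proof.
by case=> Ff fP [Fg gP]; split; [exact: Fcomp Fg | rewrite imset_comp fP].
Qed.

Lemma iso_group P (P' : {set gT}) f : iso F P P' f -> exists P1 : {group gT}, P' = P1.
Proof. by case=> Ff _; case: FS => h _ _ _ _; case/h: Ff => _ gP' _ _ _; exists (Group gP'). Qed.

Lemma F_iso P (P' : {set gT}) f : F P P' f ->
  exists P1 : {group gT}, P1 \subset P' /\ iso F P P1 f.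
Proof.
move=> Ff; have [_ _ sfP] := FSub Ff.
have Fi: iso F P (f @: P) f by split=> //; case: FS => _ _ _ _ /(_ _ _ _ Ff)[].
by have [P1 e] := iso_group Fi; exists P1; rewrite -e.
Qed.

Lemma iso_F P P' Q f : iso F P P' f -> P' \subset Q -> Q \subset S -> F P Q f.
Proof. by case=> Ff _ sP'Q sQS; apply: F_ext (Fcomp Ff (F_incl sP'Q sQS)) _. Qed.

Lemma isoFS P P' f : iso F P P' f -> F P S f.
Proof. by move=> Fi; have [_ sS] := isoS Fi; apply: iso_F Fi _ _. Qed.

Lemma iso_inv P P' f : iso F P P' f ->
  exists g, [/\ iso F P' P g, {in P, cancel f g} & {in P', cancel g f}].
Proof.
case=> Ff fP; case: FS => _ _ _ _ /(_ _ _ _ Ff)[_ [g Fg fK]].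
rewrite fP in Fg; exists g; split=> //.
  split=> //; rewrite -fP -imset_comp -[RHS]imset_id.
  by apply: eq_in_imset => x Px /=; rewrite fK.
by rewrite -fP => _ /imsetP[x Px ->]; rewrite fK.
Qed.

Lemma iso_restr R (R' : {set gT}) P f : F R R' f -> P \subset R ->
  exists P' : {group gT}, P' \subset R' /\ iso F P P' f.
Proof.
move=> Ff sPR; have [sRS _ sfR] := FSub Ff.
have /F_iso[P1 [sP1 Fi]] : F P R' f by apply: F_ext (Fcomp (F_incl sPR sRS) Ff) _.
by exists P1.
Qed.

Lemma iso_restrE R (R' : {set gT}) P (P' : {set gT}) f :
  F R R' f -> P \subset R -> f @: P = P' -> iso F P P' f.
Proof. by move=> Ff sPR <-; have [P1 [_ [Fi e]]] := iso_restr Ff sPR; split; rewrite e. Qed.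

Lemma iso_conj P u : P \subset S -> u \in S -> iso F P (P :^ u) (conjg^~ u).
Proof.
move=> sPS Su; split=> //; case: FS => _ h _ _ _.
by apply: (h P (P :^ u)%G); rewrite // -(conjGid Su) conjSg.
Qed.

Lemma F1 P (P' : {set gT}) f : F P P' f -> f 1 = 1.
Proof.
by move=> Ff; apply: (mulgI (f 1)); rewrite -(FM Ff) ?group1 ?mulg1.
Qed.

Lemma FV P (P' : {set gT}) f : F P P' f -> {in P, {morph f : x / x^-1}}.
Proof.
move=> Ff x Px; apply: (mulgI (f x)).
by rewrite -(FM Ff) ?groupV ?mulgV ?(F1 Ff).
Qed.

Lemma FJ P (P' : {set gT}) f : F P P' f -> {in P &, {morph f : x y / x ^ y}}.
Proof.
by move=> Ff x y Px Py; rewrite !conjgE !(FM Ff) ?(FV Ff) ?groupM ?groupV.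
Qed.

Lemma F_mem P (P' : {set gT}) f x : F P P' f -> x \in P -> f x \in P'.
Proof. by move=> /FSub[_ _ s] Px; apply: (subsetP s); apply: imset_f. Qed.

Lemma iso_card P (P' : {set gT}) f : iso F P P' f -> #|P'| = #|P|.
Proof. by case=> Ff <-; apply: card_in_imset; apply: FI Ff. Qed.

Lemma F_norm X (X' : {set gT}) (A B : {set gT}) f : F X X' f ->
  A \subset X -> B \subset X -> A \subset 'N(B) -> f @: A \subset 'N(f @: B).
Proof.
move=> Ff sA sB nBA; apply/subsetP=> _ /imsetP[a Aa ->].
rewrite inE; apply/subsetP=> _ /imsetP[_ /imsetP[b Bb ->] ->].
have [Xa Xb] := (subsetP sA a Aa, subsetP sB b Bb).
by rewrite -(FJ Ff) // imset_f // memJ_norm // (subsetP nBA).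
Qed.

Lemma F_cent X (X' : {set gT}) (A B : {set gT}) f : F X X' f ->
  A \subset X -> B \subset X -> A \subset 'C(B) -> f @: A \subset 'C(f @: B).
Proof.
move=> Ff sA sB /subsetP cBA; apply/subsetP=> _ /imsetP[a Aa ->].
apply/centP=> _ /imsetP[b Bb ->].
have [Xa Xb] := (subsetP sA a Aa, subsetP sB b Bb).
rewrite /commute -!(FM Ff) //; congr f.
exact: (centP (cBA a Aa)).
Qed.

Lemma AutFP P a : reflect (a \in Aut P /\ iso F P P a) (a \in AutF F P).
Proof.
apply: (iffP setIdP) => [[Aa /pboolP Fa]|[Aa [Fa _]]]; split=> //.
  by split; rewrite ?im_Aut.
exact/pboolP.
Qed.

Lemma AutF_Aut P : AutF F P \subset Aut P.
Proof. by apply/subsetP=> a /AutFP[]. Qed.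

Lemma iso_perm P f : iso F P P f -> exists2 a, a \in AutF F P & {in P, a =1 f}.
Proof.
move=> Fi; have [Ff fP] := Fi.
pose m := Morphism (FM Ff).
have im: 'injm m by apply/injmP; apply: FI Ff.
have mP: m @* P = P by rewrite morphimEdom.
exists (aut im mP); last by move=> x Px; rewrite autE.
apply/AutFP; split; first exact: Aut_aut.
by apply: isoE Fi _ => x Px; rewrite autE.
Qed.

Lemma AutF_group_set P : P \subset S -> group_set (AutF F P).
Proof.
move=> sPS; apply/group_setP; split.
  apply/AutFP; split; first exact: group1.
  by apply: isoE (iso_id sPS) _ => x _; rewrite perm1.
move=> a b /AutFP[Aa Fa] /AutFP[Ab Fb]; apply/AutFP; split; first exact: groupM.
by apply: isoE (iso_comp Fa Fb) _ => x _; rewrite permM.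
Qed.

Lemma AutS_AutF P : P \subset S -> AutS S P \subset AutF F P.
Proof.
move=> sPS; rewrite AutS_conj_aut; apply/subsetP=> _ /morphimP[g Ng /setIP[Sg _] ->].
apply/AutFP; split; first exact: Aut_aut.
have := iso_conj sPS Sg; rewrite (normP Ng) => /isoE; apply=> x Px.
by rewrite norm_conj_autE.
Qed.

Lemma Inn_AutF P : P \subset S -> Inn P \subset AutF F P.
Proof.
move=> sPS; apply: subset_trans (AutS_AutF sPS); rewrite Inn_conj_aut AutS_conj_aut.
by rewrite morphimS // subsetI sPS normG.
Qed.

(** The morphism [t] is conjugation by [f]. Since [f] and its inverse both belong to F, it matches
    the F-automorphisms of the two groups. *)
Lemma Aut_transport P P' f : iso F P P' f ->
  exists t : {morphism Aut P >-> {perm gT}},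
    [/\ 'injm t, t @* Aut P = Aut P', t @* AutF F P = AutF F P' &
        forall a, a \in Aut P -> {in P, forall x, t a (f x) = f (a x)}].
Proof.
move=> Fi; have [Ff fP] := Fi.
pose m := Morphism (FM Ff).
have im: 'injm m by apply/injmP; apply: FI Ff.
have mP: m @* P = P' by rewrite morphimEdom.
pose t : {morphism Aut P >-> {perm gT}} := Morphism (Aut_isomM im (subxx P)).
have tE a : a \in Aut P -> {in P, forall x, t a (f x) = f (a x)}.
  by move=> Aa x Px; apply: (Aut_isomE im (subxx P) Aa Px).
have it: 'injm t by apply: injm_Aut_isom.
have tP : t @* Aut P = Aut P' by rewrite -mP; apply: im_Aut_isom.
exists t; split=> //.
have [g [Gi fK gK]] := iso_inv Fi.
have tF a : a \in Aut P -> (t a \in AutF F P') = (a \in AutF F P).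
  move=> Aa; have At: t a \in Aut P' by rewrite -tP mem_morphim.
  apply/idP/idP=> /AutFP[_ Fa]; apply/AutFP; split=> //.
    apply: isoE (iso_comp Fi (iso_comp Fa Gi)) _ => x Px /=.
    by rewrite tE // fK ?Aut_mem.
  apply: isoE (iso_comp Gi (iso_comp Fa Fi)) _ => x Px /=.
  by rewrite -tE ?gK // (F_mem Gi.1).
apply/setP=> b; apply/idP/idP.
  by case/morphimP=> a Aa AFa ->; rewrite tF.
move=> AFb; have: b \in t @* Aut P by rewrite tP (subsetP (AutF_Aut P')).
case/morphimP=> a Aa _ def_b; rewrite def_b mem_morphim // -tF // -def_b //.
Qed.

End System.
End Basics.

(** * Fully automised receptive subgroups, and pairs of subgroups *)

Section Pairs.
Variables (gT : finGroupType) (p : nat) (S : {group gT}) (F : fpred gT).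
Hypotheses (pS : p.-group S) (FS : fusion_system S F).
Implicit Types (P Q R X : {group gT}) (f g : gT -> gT).

Definition receptive R := forall R' f, iso F R' R f ->
  exists psi, F (Nphi S R' f) S psi /\ {in R', psi =1 f}.

(* Saturation of a single conjugacy class, in the form of Roberts and
   Shpectorov: one member is fully automised and receptive. *)
Definition sat_class P := exists R f,
  [/\ iso F P R f, fully_automised p S F R & receptive R].

Definition pair_norm (R P : {set gT}) := 'N_S(R) :&: 'N(P).
Canonical pair_norm_group R P := [group of pair_norm R P].

Lemma pair_norm_sub (R P : {set gT}) : pair_norm R P \subset S.
Proof. by rewrite /pair_norm -setIA subsetIl. Qed.

(* "Fully automised and receptive" relative to the stabiliser of P in Aut_F(R).
   For P = R this is the absolute notion. *)
Definition good_pair R P :=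
  p.-Sylow(AutF F R :&: 'N(P | 'P)) (conj_aut R @* pair_norm R P) /\ receptive R.

Lemma F_group (P P' : {set gT}) f : F P P' f -> exists Q : {group gT}, P = Q.
Proof. by case: FS => h _ _ _ _ /h[gP _ _ _ _]; exists (Group gP). Qed.

Lemma F_restr (R : {set gT}) P (P' : {set gT}) f : F R P' f -> P \subset R -> F P P' f.
Proof.
move=> Ff; have [R1 eR] := F_group Ff; rewrite eR in Ff * => sPR.
by have [sR _ _] := FSub FS Ff; apply: (F_ext FS (Fcomp FS (F_incl FS sPR sR) Ff)).
Qed.

Lemma Nphi_sub (P : {set gT}) f : Nphi S P f \subset 'N_S(P).
Proof. by apply/subsetP=> x /setIdP[]. Qed.

Lemma Nphi_group_set P Q f : iso F P Q f -> group_set (Nphi S P f).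
Proof.
move=> Fi; have [Ff fP] := Fi; apply/group_setP; split.
  rewrite inE group1 /=; apply/existsP; exists 1; rewrite group1 /=.
  by apply/forall_inP=> x Px; rewrite !conjg1.
move=> a b /setIdP[Na /existsP[a' /andP[Na' /forall_inP aE]]].
move=> /setIdP[Nb /existsP[b' /andP[Nb' /forall_inP bE]]].
rewrite fP in Na' Nb'.
rewrite inE groupM //=; apply/existsP; exists (a' * b'); rewrite fP groupM //=.
apply/forall_inP=> x Px; rewrite !conjgM.
rewrite (eqP (bE _ _)) ?(eqP (aE _ _)) // memJ_norm //.
by case/setIP: Na.
Qed.

Lemma norm_grow P R : R \subset S -> P \proper R -> P \proper 'N_R(P).
Proof.
by move=> sRS; apply: nilpotent_proper_norm; apply: pgroup_nil (pgroupS sRS pS).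
Qed.

Lemma conj_aut_pair_norm R P : P \subset R -> conj_aut R @* pair_norm R P = AutS S R :&: 'N(P | 'P).
Proof.
move=> sPR; rewrite AutS_conj_aut; apply/setP=> a; apply/idP/setIP.
  case/morphimP=> g Ng /setIP[Sg NPg] ->; split; first exact: mem_morphim.
  apply/astabsP=> x /=; rewrite apermE.
  have [Rx|nRx] := boolP (x \in R); first by rewrite norm_conj_autE // memJ_norm.
  (* An automorphism of [R] is a permutation of the whole type that fixes every element outside
     [R]. *)
  by rewrite (out_Aut (Aut_aut _ _)).
case=> /morphimP[g Ng Sg ->] /astabsP NPa; apply: mem_morphim => //.
apply/setIP; split=> //; rewrite inE; apply/subsetP=> _ /imsetP[x Px ->].
by have := NPa x; rewrite Px /= apermE norm_conj_autE ?(subsetP sPR).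
Qed.

(** In a fully automised receptive conjugate [R1] of [R], let [P2] be the image of [P] and [T] a
    Sylow p-subgroup of the stabiliser of [P2]. Some F-automorphism [a] conjugates [T] into
    [AutS S R1], and moving [P2] by [a] makes [T :^ a] a Sylow p-subgroup of the new stabiliser. As
    [T :^ a] is contained in the p-group induced by [pair_norm R1 P1], the two agree. *)
Lemma good_pair_exists P R : sat_class R -> P \subset R -> 
  exists R1 P1 f, [/\ iso F R R1 f, f @: P = P1 & good_pair R1 P1].
Proof.
case=> R1 [f0 [Fi fa rec]] sPR.
have [sRS sR1S] := isoS FS Fi.
have [P2 [sP2 FP]] := iso_restr FS Fi.1 sPR.
have [A defA] : exists A : {group {perm gT}}, AutF F R1 = A.
  by exists (Group (AutF_group_set FS sR1S)).
have [T sylT] := Sylow_exists p (A :&: 'N(P2 | 'P)).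
have [sTA pT] := (subset_trans (pHall_sub sylT) (subsetIl _ _), pHall_pgroup sylT).
move: fa; rewrite /fully_automised AutS_conj_aut defA => fa.
have [a Aa sTa] := Sylow_Jsub fa sTA pT.
have Fa : a \in AutF F R1 by rewrite defA.
have /AutFP[_ Fia] := Fa.
have [P1 [sP1 FP1]] := iso_restr FS Fia.1 sP2.
exists R1, P1, (a \o f0); split; first exact (iso_comp FS Fi Fia).
  by rewrite imset_comp FP.2 FP1.2.
split=> //; rewrite defA.
have NP1 : 'N(P1 | 'P) = 'N(P2 | 'P) :^ a.
  by rewrite -!astab1_set -astab1_act; congr 'C[_ | _]; rewrite -FP1.2.
have sylTa : p.-Sylow(A :&: 'N(P1 | 'P)) (T :^ a).
  by rewrite NP1 -{1}(conjGid Aa) -conjIg pHallJ2.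
suff <- : T :^ a = conj_aut R1 @* pair_norm R1 P1 by [].
apply/esym; apply: (sub_pHall sylTa).
- apply: morphim_pgroup; exact: pgroupS (pair_norm_sub _ _) pS.
- rewrite /= conj_aut_pair_norm // AutS_conj_aut subsetI sTa.
  by rewrite (subset_trans (pHall_sub sylTa)) ?subsetIr.
by rewrite /= conj_aut_pair_norm // -defA setSI // (AutS_AutF FS).
Qed.

(* By Sylow's theorem in B T, where T is the group of automorphisms of R1 induced by
   N_S(R1) and stabilising P1, an element of B conjugates the transported action of X into T. *)
Lemma good_pair_extend R1 P1 R P f (B : {group {perm gT}}) X :
    good_pair R1 P1 -> P1 \subset R1 -> iso F R R1 f ->
    B <| AutF F R1 :&: 'N(P1 | 'P) -> R \subset X -> X \subset pair_norm R P ->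
    (forall x, x \in X -> exists b t, [/\ b \in B, t \in pair_norm R1 P1 &
        {in R, forall y, f (y ^ x) = b (f y) ^ t}]) ->
  exists b psi, [/\ b \in B, F X S psi & {in R, psi =1 b \o f}].
Proof.
case=> sylT rec sP1 Fi nBA sRX sXN hX.
have [sRS sR1S] := isoS FS Fi.
have [tr [injt tA tF trE]] := Aut_transport FS Fi.
have nXR x : x \in X -> x \in 'N(R).
  by move=> Xx; have /setIP[/setIP[]] := subsetP sXN x Xx.
set T := conj_aut R1 @* pair_norm R1 P1 in sylT.
have [sBA sBN] := andP nBA.
have sTA := pHall_sub sylT.
have defBT : B <*> T = B * T.
  by apply: norm_joinEr; apply: subset_trans sTA sBN.
have trX x : x \in X -> tr (conj_aut R x) \in B * T.
  move=> Xx; have [b [t [Bb Nt bt]]] := hX x Xx.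
  have Nt1 : t \in 'N(R1) by have /setIP[/setIP[]] := Nt.
  have Ab: b \in Aut R1.
    by apply: (subsetP (AutF_Aut F R1)); have /setIP[] := subsetP sBA b Bb.
  apply/mulsgP; exists b (conj_aut R1 t) => //; first exact: mem_morphim.
  apply: (@eq_Aut _ R1); first by rewrite -tA mem_morphim ?Aut_aut.
    by rewrite groupM ?Aut_aut.
  move=> _z; rewrite -{1}Fi.2 => /imsetP[y Ry ->].
  rewrite trE ?Aut_aut // norm_conj_autE ?nXR // bt // permM norm_conj_autE //.
  by apply: Aut_mem => //; apply: (F_mem FS Fi.1).
pose Y := tr @* (conj_aut R @* X).
have sYBT : Y \subset B <*> T.
  rewrite defBT; apply/subsetP=> _ /morphimP[_ _ /morphimP[x _ Xx ->] ->].
  exact: trX.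
have pX : p.-group X.
  by apply: pgroupS pS; apply: subset_trans sXN (pair_norm_sub _ _).
have pY : p.-group Y by do 2!apply: morphim_pgroup.
have [A defA] : exists A : {group {perm gT}}, AutF F R1 = A.
  by exists (Group (AutF_group_set FS sR1S)).
rewrite defA in sBA sTA sylT.
have sylBT : p.-Sylow(B <*> T) T.
  apply: (pHall_subl _ _ sylT); first exact: joing_subr.
  by rewrite join_subG sBA.
have [v BTv sYT] := Sylow_Jsub sylBT sYBT pY.
(* The conjugating element is a product [b * u] with [u] in [T]; as [u] normalises [T], the factor
   [b] alone conjugates into [T]. *)
have /mulsgP[b u Bb Tu defv] : v \in B * T by rewrite -defBT.
rewrite {v BTv}defv in sYT.
have sYbT : Y :^ b \subset T.
  by rewrite -(conjSg _ _ u) -conjsgM (conjGid Tu).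
exists b; pose f' := b \o f.
have Fb : b \in AutF F R1 by rewrite defA; have /setIP[] := subsetP sBA b Bb.
have Fi' : iso F R R1 f'.
  have /AutFP[_ Fb'] := Fb.
  exact (iso_comp FS Fi Fb').
(* Now conjugation by any element of [X] becomes, through [f'], conjugation by an element of
   [N_S(R1)], so [X] lies in the domain of the extension that receptivity provides. *)
have [psi [Fpsi psiE]] := rec R f' Fi'.
exists psi; split=> //; apply: F_restr Fpsi _; apply/subsetP=> x Xx.
have /setIP[NSx NPx] := subsetP sXN x Xx.
apply/setIdP; split=> //; rewrite Fi'.2; apply/existsP.
have: tr (conj_aut R x) ^ b \in T.
  by apply: (subsetP sYbT); rewrite memJ_conjg !mem_morphim ?Aut_aut ?nXR.
case/morphimP=> h Nh1 /setIP[NSh _] eh; exists h; rewrite NSh /=.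
apply/forall_inP=> y Ry; apply/eqP; rewrite /f' /=.
have <- : conj_aut R1 h (b (f y)) = b (f y) ^ h.
  apply: norm_conj_autE => //; apply: (Aut_mem (subsetP (AutF_Aut F R1) b Fb)).
  exact: (F_mem FS Fi.1).
by rewrite -eh permJ trE ?Aut_aut // norm_conj_autE ?nXR.
Qed.

(** With the whole stabiliser of [P1] for [B], the condition on [X] in [good_pair_extend] is empty:
    the transported action of [x] already lies in [B], and [t = 1] will do. So an isomorphism of
    pairs extends to all of [pair_norm R P], up to an automorphism of [(R1, P1)]. *)
Lemma good_pair_norm R1 P1 R P f :
    good_pair R1 P1 -> iso F R R1 f -> P \subset R -> R \subset 'N(P) ->
    f @: P = P1 ->
  exists a psi, [/\ a \in AutF F R1 :&: 'N(P1 | 'P), F (pair_norm R P) S psi,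
     {in R, psi =1 a \o f} &
     [/\ psi @: R = R1, psi @: P = P1 & psi @: pair_norm R P \subset pair_norm R1 P1]].
Proof.
move=> gp Fi sPR nPR fP.
have [sRS sR1S] := isoS FS Fi.
have [tr [injt tA tF trE]] := Aut_transport FS Fi.
have sP1 : P1 \subset R1 by rewrite -fP -Fi.2 imsetS.
have [A defA] : exists A : {group {perm gT}}, AutF F R1 = A.
  by exists (Group (AutF_group_set FS sR1S)).
have sRN : R \subset pair_norm R P by rewrite !subsetI sRS normG.
have := @good_pair_extend R1 P1 R P f [group of A :&: 'N(P1 | 'P)] (pair_norm R P).
case=> //; first by rewrite defA.
  move=> x Nx; have /setIP[NSx NPx] := Nx; have NRx : x \in 'N(R) by case/setIP: NSx.
  exists (tr (conj_aut R x)), 1; rewrite group1; split=> //.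
    rewrite /= -defA; apply/setIP; split.
      rewrite -tF mem_morphim ?Aut_aut //; apply: (subsetP (AutS_AutF FS sRS)).
      by rewrite AutS_conj_aut mem_morphim.
    rewrite !inE /=; apply/subsetP=> z; rewrite -fP => /imsetP[y Py ->].
    rewrite ?inE /= apermE trE ?Aut_aut ?(subsetP sPR) //.
    by rewrite norm_conj_autE ?(subsetP sPR) // imset_f // memJ_norm.
  by move=> y Ry; rewrite conjg1 trE ?Aut_aut // norm_conj_autE.
move=> a [psi [Aa Fpsi psiE]]; exists a, psi; rewrite defA; split=> //.
have [Aa1 NPa] := setIP Aa.
have Aua : a \in Aut R1 by apply: (subsetP (AutF_Aut F R1)); rewrite defA.
have psiR : psi @: R = R1.
  by rewrite (eq_in_imset psiE) imset_comp Fi.2 im_Aut.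
have psiP : psi @: P = P1.
  rewrite (@eq_in_imset _ _ psi (a \o f)) => [|x Px]; last exact/psiE/(subsetP sPR).
  by rewrite imset_comp fP; have := astabs_setact NPa.
have sNR : pair_norm R P \subset 'N(R) by rewrite /pair_norm subIset // subsetIr.
have sNP : pair_norm R P \subset 'N(P) by apply: subsetIr.
split=> //; rewrite !subsetI -{1}psiR -psiP; have [_ _ ->] := FSub FS Fpsi.
by rewrite !(F_norm FS Fpsi) // (subset_trans sPR).
Qed.

End Pairs.

(** * Chains of extendable isomorphisms *)

Section Centric.
Variables (gT : finGroupType) (p : nat) (S : {group gT}) (F : fpred gT).
Hypotheses (pS : p.-group S) (FS : fusion_system S F).
Implicit Types (P Q R X W : {group gT}) (f g : gT -> gT).

(* Composites of isomorphisms each of which extends to a strictly larger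
   subgroup. *)
Inductive ext_chain : {group gT} -> {group gT} -> (gT -> gT) -> Prop :=
| ExtId P f : {in P, f =1 id} -> ext_chain P P f
| ExtStep P P1 P2 R g f h : P \proper R -> F R S g -> g @: P = P1 ->
    ext_chain P1 P2 f -> {in P, h =1 f \o g} -> ext_chain P P2 h.

(** Such an [f] carries [N_S(P)] into [N_S(Q)]. *)
Definition norm_embeds P Q := exists f, F 'N_S(P) S f /\ f @: P = Q.

(** Here [B] consists of the F-automorphisms of [R1] that fix [P1] pointwise. If [t] realises the
    action of [x] on [P] only, then the transported action of [x] followed by the inverse of
    conjugation by [t] lies in [B]. Correcting by elements of [B] does not change [f] on [P]. *)
Lemma good_pair_extend_cent R1 P1 R P f X :
    good_pair p S F R1 P1 -> P1 \subset R1 -> P \subset R -> iso F R R1 f ->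
    f @: P = P1 -> R \subset X -> X \subset pair_norm S R P ->
    (forall x, x \in X ->
       exists2 t, t \in pair_norm S R1 P1 & {in P, forall y, f (y ^ x) = f y ^ t}) ->
  exists psi, [/\ F X S psi, {in P, psi =1 f} & psi @: R = R1].
Proof.
move=> gp sP1 sPR Fi fP sRX sXN hX.
have [sRS sR1S] := isoS FS Fi.
have [tr [injt tA tF trE]] := Aut_transport FS Fi.
have [A defA] : exists A : {group {perm gT}}, AutF F R1 = A.
  by exists (Group (AutF_group_set FS sR1S)).
have sRP y : y \in P -> y \in R by apply: subsetP.
have AA1 a : a \in A -> a \in Aut R1 by rewrite -defA; apply: (subsetP (AutF_Aut F R1)).
have := @good_pair_extend _ p S F pS FS R1 P1 R P f [group of A :&: 'C(P1 | 'P)] X gp.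
case=> //.
- rewrite /= defA; apply/andP; split; first by rewrite setIS // astab_sub.
  by apply: normsI; [rewrite subIset // normG | rewrite subIset // astab_norm orbT].
- move=> x Xx; have [t Nt ft] := hX x Xx.
  have /setIP[/setIP[Sx NRx] NPx] := subsetP sXN x Xx.
  have NRt : t \in 'N(R1) by case/setIP: Nt => /setIP[].
  have Ac : tr (conj_aut R x) \in A.
    rewrite -defA -tF mem_morphim ?Aut_aut //; apply: (subsetP (AutS_AutF FS sRS)).
    by rewrite AutS_conj_aut mem_morphim // inE Sx.
  have At : conj_aut R1 t \in A.
    rewrite -defA; apply: (subsetP (AutS_AutF FS sR1S)).
    by rewrite AutS_conj_aut mem_morphim //; case/setIP: Nt.
  have bE y : y \in R ->
      (tr (conj_aut R x) * (conj_aut R1 t)^-1) (f y) = f (y ^ x) ^ t^-1.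
    move=> Ry; rewrite permM trE ?Aut_aut // norm_conj_autE // -morphV //=.
    by rewrite norm_conj_autE ?groupV // (F_mem FS Fi.1) ?memJ_norm.
  exists (tr (conj_aut R x) * (conj_aut R1 t)^-1), t; split=> //.
  + rewrite /= inE groupM ?groupV //=; apply/astabP=> z /=.
    rewrite -{1}fP => /imsetP[y Py ->].
    by rewrite apermE bE ?sRP // ft // conjgK.
  by move=> y Ry; rewrite bE // conjgKV.
move=> b [psi [/setIP[Ab Cb] Fpsi psiE]]; exists psi; split=> //.
- move=> y Py; rewrite psiE ?sRP //=.
  by have := astabP Cb (f y); rewrite -fP imset_f //; apply.
by rewrite (eq_in_imset psiE) imset_comp Fi.2 im_Aut ?AA1.
Qed.

(** Normalisers grow in p-groups, so an extension of an isomorphism to some larger subgroup can be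
    cut down to one inside the normaliser. *)
Lemma isoT_restr P Q R g : F R S g -> P \proper R -> g @: P = Q ->
  [/\ P \proper 'N_R(P), F 'N_R(P) S g, 'N_R(P) \subset 'N_S(P)
    & g @: 'N_R(P) \subset 'N_S(Q)].
Proof.
move=> Fg prPR gP; have [sRS sgS sgR] := FSub FS Fg.
have sN : 'N_R(P) \subset R by apply: subsetIl.
split; first exact: norm_grow pS _ _ sRS prPR.
- exact: F_restr FS _ _ _ _ Fg sN.
- exact: setSI.
rewrite subsetI -gP (subset_trans (imsetS g sN) sgR).
by rewrite (F_norm FS Fg) ?(proper_sub prPR) // subsetIr.
Qed.

(** * Isomorphisms onto a conjugate with the largest normaliser: embedding normalisers, extending
    over centralisers *)

Section Class.
Variable Q : {group gT}.
Hypotheses (satQ : forall R, R \subset S -> #|Q| < #|R| -> sat_class p S F R)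
  (maxQ : forall P f, iso F P Q f -> #|'N_S(P)| <= #|'N_S(Q)|).

Lemma pair_norm_grow R P : R \proper 'N_S(P) -> #|R| < #|pair_norm S R P|.
Proof.
move=> prR; apply: proper_card; have := norm_grow pS (subsetIl _ _) prR.
by rewrite /pair_norm setIAC.
Qed.

Lemma sub_pair_norm R P : R \subset 'N_S(P) -> R \subset pair_norm S R P.
Proof. by rewrite !subsetI normG => /andP[-> ->]. Qed.

(* Both N(R) and N(f R) map into the normaliser of a good pair, so that the claim
   reduces to subgroups larger than R. *)
Lemma norm_embeds_step P R g : P \proper R -> R \subset 'N_S(P) -> F R S g ->
  g @: P = Q -> norm_embeds P Q.
Proof.
have [n] := ubnP (#|S| - #|R|); elim: n P R g => // n IH P R g leRn prPR sRN Fg gP.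
have [sPR _] := andP prPR.
have [eRN|prR] := eqVproper sRN; first by exists g; rewrite -eRN.
have sRS: R \subset S by have [] := FSub FS Fg.
have [R' [sR'S Fi]] := F_iso FS Fg.
have FP: iso F P Q g by apply: iso_restrE FS _ _ _ _ _ Fg sPR gP.
have sQR' : Q \subset R' by rewrite -gP -Fi.2 imsetS.
have nQR' : R' \subset 'N(Q).
  by rewrite -gP -Fi.2 (F_norm FS Fg) // (subset_trans sRN) ?subsetIr.
have sR'N : R' \subset 'N_S(Q) by rewrite subsetI sR'S.
(* Maximality of the normaliser of [Q] enters here: the order of [R'] is that of [R], less than that
   of [N_S(P)], which is at most that of [N_S(Q)]. *)
have prR' : R' \proper 'N_S(Q).
  rewrite properEcard sR'N (iso_card FS Fi) (leq_trans (proper_card prR)) //.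
  exact: maxQ FP.
have ltQR' : #|Q| < #|R'| by rewrite (iso_card FS Fi) (iso_card FS FP) proper_card.
have [R1 [P1 [th [Fth thQ gp]]]] := good_pair_exists pS FS (satQ sR'S ltQR') sQR'.
have [_ [psi1 [_ Fpsi1 _ [psi1R psi1Q psi1N]]]] :=
  good_pair_norm pS FS gp Fth sQR' nQR' thQ.
have nPR : R \subset 'N(P) by rewrite (subset_trans sRN) ?subsetIr.
have thgP : (th \o g) @: P = P1 by rewrite imset_comp gP.
have [_ [psi2 [_ Fpsi2 _ [psi2R psi2P psi2N]]]] :=
  good_pair_norm pS FS gp (iso_comp FS Fi Fth) sPR nPR thgP.
have ltNR : #|R| < #|pair_norm S R P| by apply: pair_norm_grow.
have ltNR' : #|R'| < #|pair_norm S R' Q| by apply: pair_norm_grow.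
have ltn (N : {set gT}) : N \subset S -> #|R| < #|N| -> #|S| - #|N| < n.
  move=> sNS ltRN; apply: leq_trans (_ : #|S| - #|R| <= n); last by rewrite -ltnS.
  apply: ltn_sub2l => //; apply: (leq_trans ltRN); exact: subset_leq_card.
(* The inverse of [psi1] maps [P1] to [Q] and is defined on a normalising subgroup larger than [R],
   so the induction hypothesis applies to it. *)
have [chi [Fchi chiP]] : norm_embeds P1 Q.
  have [R3 [sR3S Fi3]] := F_iso FS Fpsi1.
  have [h [Fh hK Kh]] := iso_inv FS Fi3.
  have sP1R3 : P1 \subset R3 by rewrite -Fi3.2 -psi1Q imsetS // (subset_trans sQR') ?sub_pair_norm.
  have ltR3 : #|R| < #|R3| by rewrite (iso_card FS Fi3) -(iso_card FS Fi).
  apply: (IH P1 R3 h); first exact: ltn.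
  - rewrite properEcard sP1R3 /=; apply: leq_ltn_trans ltR3.
    rewrite -psi1Q -(iso_card FS Fi); apply: leq_trans (leq_imset_card _ _) _.
    exact: ltnW.
  - rewrite -Fi3.2 (subset_trans psi1N) // subsetI pair_norm_sub.
    by rewrite subsetIr.
  - exact (isoFS FS Fh).
  rewrite -psi1Q -imset_comp -[RHS]imset_id; apply: eq_in_imset => x Qx /=.
  by rewrite hK // (subsetP (sub_pair_norm sR'N)) // (subsetP sQR').
(* The composite of [psi2] and [chi] maps [P] to [Q] and is defined on [pair_norm S R P], again
   larger than [R]. *)
apply: (IH P (pair_norm_group S R P) (chi \o psi2)).
- by apply: ltn => //; apply: pair_norm_sub.
- by apply: proper_sub_trans prPR _; apply: sub_pair_norm.
- by rewrite subsetI pair_norm_sub subsetIr.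
- have [R4 [sR4 Fi4]] := F_iso FS Fpsi2.
  apply: Fcomp FS _ _ _ _ _ Fi4.1 _; apply: F_restr FS _ _ _ _ Fchi _.
  by rewrite -Fi4.2 (subset_trans psi2N) // subsetI pair_norm_sub subsetIr.
by rewrite imset_comp psi2P chiP.
Qed.

(** Induction from the target end: if the rest of the chain yields an embedding [psi] of [N_S(P1)],
    then the first link [g], restricted to [N_R(P)], lands in [N_S(P1)]. So [psi \o g] is defined on
    a subgroup larger than [P], and [norm_embeds_step] finishes. *)
Lemma ext_chain_norm_embeds P Q' f : ext_chain P Q' f -> Q' = Q -> norm_embeds P Q.
Proof.
elim=> {P Q' f} [P f fE eP|P P1 P2 R g f h prPR Fg gP _ IH hE eQ].
  by rewrite eP; exists id; rewrite imset_id; split=> //; apply: (F_incl FS) (subsetIl _ _) _.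
have [psi [Fpsi psiP]] := IH eQ.
have [prN FN sN sgN] := isoT_restr Fg prPR gP.
apply: (norm_embeds_step prN sN (g := psi \o g)).
  have [R4 [sR4 Fi4]] := F_iso FS FN.
  apply: Fcomp FS _ _ _ _ _ Fi4.1 _; apply: F_restr FS _ _ _ _ Fpsi _.
  by rewrite -Fi4.2.
by rewrite imset_comp gP.
Qed.

Hypothesis genQ : forall P P' f g, iso F P Q g -> iso F P P' f -> ext_chain P P' f.

Lemma conj_norm_embeds P f : iso F P Q f -> norm_embeds P Q.
Proof. by move=> Fi; apply: ext_chain_norm_embeds (genQ Fi Fi) _. Qed.

Let W := Q <*> 'C_S(Q).

Definition cent_ext f := exists h, iso F W W h /\ {in Q, h =1 f}.

Lemma cent_ext_eq f g : {in Q, f =1 g} -> cent_ext f -> cent_ext g.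
Proof.
by move=> fg [h [Fh hE]]; exists h; split=> // x Qx; rewrite hE ?fg.
Qed.

Lemma cent_ext_comp f g : f @: Q = Q -> cent_ext f -> cent_ext g -> cent_ext (g \o f).
Proof.
move=> fQ [h [Fh hE]] [k [Fk kE]]; exists (k \o h); split; first exact (iso_comp FS Fh Fk).
by move=> x Qx /=; rewrite hE // kE // -fQ imset_f.
Qed.

Lemma cent_ext_inv f g : f @: Q = Q -> cent_ext f -> {in Q, cancel f g} -> cent_ext g.
Proof.
move=> fQ [h [Fh hE]] fK; have [k [Fk kK Kk]] := iso_inv FS Fh.
exists k; split=> //; rewrite -fQ => _ /imsetP[x Qx ->].
by rewrite fK // -hE // kK // (subsetP (joing_subl _ _)).
Qed.

(** As [f] stabilises [Q], it maps elements centralising [Q] to elements centralising [Q]; hence it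
    stabilises [W], by injectivity and finiteness. *)
Lemma cent_ext_group X f : F X S f -> Q \subset X -> 'C_S(Q) \subset X -> f @: Q = Q ->
  cent_ext f.
Proof.
move=> Ff sQX sCX fQ; exists f; split=> //.
have sWX : W \subset X by rewrite join_subG sQX.
have [W1 [_ Fi]] := iso_restr FS Ff sWX.
have defW : W = Q * 'C_S(Q) by rewrite /W cent_joinEr // subsetIr.
suff sW : f @: W \subset W.
  have eW : W1 = W :> {set gT}.
    by apply/eqP; rewrite eqEcard (iso_card FS Fi) leqnn andbT -Fi.2.
  by rewrite -{2}eW.
apply/subsetP=> _ /imsetP[w Ww ->].
move: Ww; rewrite defW => /mulsgP[q c Qq Cc ->].
have [Xq Xc] := (subsetP sQX q Qq, subsetP sCX c Cc).
rewrite (FM FS Ff) //; apply: mem_mulg.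
  by rewrite -fQ imset_f.
have [_ _ sfX] := FSub FS Ff.
have := F_cent FS Ff sCX sQX (subsetIr _ _); rewrite fQ => sfC.
apply/setIP; split.
  by apply: (subsetP sfX); rewrite imset_f // (subsetP sCX).
by apply: (subsetP sfC); rewrite imset_f.
Qed.

(** Induction on the index of [R] in [S]; if [C_S(Q)] lies in [R], then [f] itself restricts to [W].
    Otherwise move [(f R, Q)] to a good pair [(R1, P1)] by [psi], which is defined on more than
    [f R]. The map [psi \o f] need not extend beyond [R], but some [om] equal to it on [Q] is
    defined on the normaliser of [R] in [R C_S(Q)]. Returning from [P1] to [Q] by a normaliser
    embedding [chi] writes [f] on [Q] as the quotient of [chi \o om] by [chi \o psi], and both of
    these are covered by induction. *)
Lemma cent_ext_step R f : Q \proper R -> R \subset 'N_S(Q) -> F R S f -> f @: Q = Q ->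
  cent_ext f.
Proof.
have [n] := ubnP (#|S| - #|R|); elim: n R f => // n IH R f leRn prQR sRN Ff fQ.
have [sQR _] := andP prQR.
have [sCR|nsCR] := boolP ('C_S(Q) \subset R); first exact: cent_ext_group Ff _ _ _.
have sRS: R \subset S by have [] := FSub FS Ff.
have sCN : 'C_S(Q) \subset 'N_S(Q) by rewrite setIS // cent_sub.
have prR : R \proper 'N_S(Q).
  by rewrite properE sRN; apply: contra nsCR; apply: subset_trans.
have [R' [sR'S Fi]] := F_iso FS Ff.
have sQR' : Q \subset R' by rewrite -fQ -Fi.2 imsetS.
have nQR : R \subset 'N(Q) by rewrite (subset_trans sRN) ?subsetIr.
have nQR' : R' \subset 'N(Q) by rewrite -fQ -Fi.2 (F_norm FS Ff).
have sR'N : R' \subset 'N_S(Q) by rewrite subsetI sR'S.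
have prR' : R' \proper 'N_S(Q).
  by rewrite properEcard sR'N (iso_card FS Fi) proper_card.
have prQR' : Q \proper R' by rewrite properEcard sQR' (iso_card FS Fi) proper_card.
have [R1 [P1 [th [Fth thQ gp]]]] :=
  good_pair_exists pS FS (satQ sR'S (proper_card prQR')) sQR'.
have [_ [psi [_ Fpsi _ [psiR psiQ psiN]]]] :=
  good_pair_norm pS FS gp Fth sQR' nQR' thQ.
have ltn (N : {set gT}) : N \subset S -> #|R| < #|N| -> #|S| - #|N| < n.
  move=> sNS ltRN; apply: leq_trans (_ : #|S| - #|R| <= n); last by rewrite -ltnS.
  by apply: ltn_sub2l => //; apply: (leq_trans ltRN); exact: subset_leq_card.
have Fi2 : iso F R R1 (psi \o f).
  apply: iso_comp FS _ _ _ _ _ Fi _; apply: iso_restrE FS _ _ _ _ _ Fpsi _ psiR.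
  exact: sub_pair_norm.
have f2Q : (psi \o f) @: Q = P1 by rewrite imset_comp fQ.
have sP1R1 : P1 \subset R1 by rewrite -psiQ -psiR imsetS.
have nR1P1 : R1 \subset 'N(P1).
  by rewrite -Fi2.2 -f2Q (F_norm FS Fi2.1).
pose RC := R <*> 'C_S(Q).
have nCR : R \subset 'N('C_S(Q)).
  by rewrite normsI ?norms_cent // (subset_trans sRS) ?normG.
have defRC : RC = R * 'C_S(Q) by apply: norm_joinEl.
have prRC : R \proper RC.
  rewrite properE joing_subl; apply: contra nsCR; apply: subset_trans.
  exact: joing_subr.
have sRCS : RC \subset S by rewrite join_subG sRS subsetIl.
have prX := norm_grow pS sRCS prRC.
have sXN : 'N_RC(R) \subset pair_norm S R Q.
  rewrite /pair_norm setIAC setISS // subsetI sRCS join_subG nQR.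
  by rewrite (subset_trans (subsetIr _ _)) // cent_sub.
have [om [Fom omE _]] : exists om,
    [/\ F 'N_RC(R) S om, {in Q, om =1 psi \o f} & om @: R = R1].
  apply: (good_pair_extend_cent gp sP1R1 sQR Fi2 f2Q (proper_sub prX) sXN).
  move=> x /setIP[RCx NRx].
  (* The factor [c] centralises [Q], so [x] acts on [Q] as [r] does, and the image of [r] in [R1]
     realises that action on [P1]. *)
  have /mulsgP[r c Rr Cc ex] : x \in R * 'C_S(Q) by rewrite -defRC.
  exists ((psi \o f) r).
    have R1r : (psi \o f) r \in R1 by rewrite -Fi2.2 imset_f.
    apply: subsetP R1r; apply: sub_pair_norm; rewrite subsetI nR1P1 andbT.
    by have [] := isoS FS Fi2.
  move=> y Qy; rewrite ex conjgM.
  have Qyr : y ^ r \in Q by rewrite memJ_norm // (subsetP nQR).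
  have -> : (y ^ r) ^ c = y ^ r.
    apply/conjg_fixP/commgP/commute_sym.
    by have /setIP[_ /centP cQc] := Cc; apply: cQc.
  by rewrite (FJ FS Fi2.1) // (subsetP sQR).
have FP1 : exists k, iso F P1 Q k.
  have FQ : iso F Q P1 th by apply: iso_restrE FS _ _ _ _ _ Fth.1 sQR' thQ.
  by have [k [Fk _ _]] := iso_inv FS FQ; exists k.
have [k Fk] := FP1; have [chi [Fchi chiP]] := conj_norm_embeds Fk.
have Fcomp_chi X g : F X S g -> X \subset 'N(Q) -> Q \subset X -> g @: Q = P1 -> F X S (chi \o g).
  move=> Fg nQX sQX gQ; have [X1 [sX1 Fi1]] := F_iso FS Fg.
  apply: Fcomp FS _ _ _ _ _ Fi1.1 _; apply: F_restr FS _ _ _ _ Fchi _.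
  by rewrite subsetI sX1 -Fi1.2 -gQ (F_norm FS Fg).
have omQ : om @: Q = P1 by rewrite (eq_in_imset omE).
have e1 : cent_ext (chi \o om).
  have nQX : 'N_RC(R) \subset 'N(Q) by rewrite (subset_trans sXN) ?subsetIr.
  have sXS : 'N_RC(R) \subset S by rewrite (subset_trans sXN) ?pair_norm_sub.
  apply: (IH [group of 'N_RC(R)]).
  - by apply: ltn => //; apply: proper_card.
  - exact: proper_trans prQR prX.
  - by rewrite subsetI sXS.
  - by apply: Fcomp_chi => //; apply: subset_trans sQR (proper_sub prX).
  by rewrite imset_comp omQ chiP.
have e2 : cent_ext (chi \o psi).
  have ltNR' := pair_norm_grow prR'.
  apply: (IH (pair_norm_group S R' Q)).
  - by apply: ltn; rewrite ?pair_norm_sub // -(iso_card FS Fi).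
  - by apply: proper_sub_trans prQR' _; apply: sub_pair_norm.
  - by rewrite subsetI pair_norm_sub subsetIr.
  - apply: Fcomp_chi => //; first by rewrite subsetIr.
    by apply: subset_trans sQR' _; apply: sub_pair_norm.
  by rewrite imset_comp psiQ chiP.
have [u [Fu uK Ku]] : exists u, [/\ iso F Q Q u, {in Q, cancel (chi \o psi) u}
    & {in Q, cancel u (chi \o psi)}].
  apply: (iso_inv FS); split; last by rewrite imset_comp psiQ chiP.
  have : F Q S (chi \o psi).
    apply: F_restr FS (pair_norm S R' Q) _ _ _ _ _; last first.
      by apply: subset_trans sQR' _; apply: sub_pair_norm.
    apply: (Fcomp_chi (pair_norm_group S R' Q)) => //; first by rewrite subsetIr.
    by apply: subset_trans sQR' _; apply: sub_pair_norm.
  move=> Fcp; have [Q1 [sQ1 Fi1]] := F_iso FS Fcp.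
  have eQ1 : Q1 = Q :> {set gT} by rewrite -Fi1.2 imset_comp psiQ chiP.
  by have := Fi1.1; rewrite eQ1.
have cpQ : (chi \o psi) @: Q = Q by rewrite imset_comp psiQ chiP.
have coQ : (chi \o om) @: Q = Q by rewrite imset_comp omQ chiP.
apply: (@cent_ext_eq (u \o (chi \o om))).
  by move=> x Qx /=; rewrite omE //= [LHS]uK // -fQ imset_f.
by apply: cent_ext_comp => //; apply: cent_ext_inv e2 uK.
Qed.

(** Any embedding [chi] of [N_S(P)] agrees with [f] up to an F-automorphism of [W]. Inductively,
    take [chi1] for the next group of the chain. Then [chi1 \o g \o chi^-1] stabilises [Q] and is
    defined on the image of [N_R(P)] under [chi], which is larger than [Q]; so [cent_ext_step]
    extends its restriction to [Q] over [W]. *)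
Lemma cent_ext_norm P f chi : Q \proper S -> ext_chain P Q f ->
  F 'N_S(P) S chi -> chi @: P = Q ->
  exists h, iso F W W h /\ {in P, forall x, h (chi x) = f x}.
Proof.
move=> prQ; have prQN := norm_grow pS (subxx _) prQ.
move=> gf; have [Q' eQ'] : exists Q', Q' = Q by exists Q.
rewrite -{1}eQ' in gf; elim: gf eQ' chi => {P Q' f}.
  move=> P f fE eP chi Fchi chiP; rewrite eP in fE Fchi chiP *.
  have [h [Fh hE]] := cent_ext_step prQN (subxx _) Fchi chiP.
  have [k [Fk hK _]] := iso_inv FS Fh.
  exists k; split=> // x Qx.
  by rewrite -hE // hK ?fE // (subsetP (joing_subl _ _)).
move=> P P1 P2 R g f h prPR Fg gP gf IH hE eP2 chi Fchi chiP.
have [chi1 [Fchi1 chi1P]] := ext_chain_norm_embeds gf eP2.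
have [h1 [Fh1 h1E]] := IH eP2 chi1 Fchi1 chi1P.
have [prN FN sN sgN] := isoT_restr Fg prPR gP.
have [X [sX FX]] := F_iso FS (F_restr FS Fchi sN).
have [k [Fk kK Kk]] := iso_inv FS FX.
have sPN : P \subset 'N_R(P) := proper_sub prN.
have kQ : k @: Q = P.
  rewrite -chiP -imset_comp -[RHS]imset_id; apply: eq_in_imset => x Px /=.
  by rewrite kK // (subsetP sPN).
have FP : iso F P Q chi by apply: iso_restrE FS _ _ _ _ _ FX.1 sPN chiP.
have sQX : Q \subset X by rewrite -FX.2 -chiP imsetS.
have prQX : Q \proper X.
  by rewrite properEcard sQX (iso_card FS FX) (iso_card FS FP) proper_card.
have sXN : X \subset 'N_S(Q).
  rewrite subsetI sX -FX.2 -chiP (F_norm FS FX.1) //; exact: subsetIr.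
have FX2 : F X S (chi1 \o (g \o k)).
  have [X2 [sX2 FX2]] := F_iso FS (Fcomp FS Fk.1 FN).
  apply: Fcomp FS _ _ _ _ _ FX2.1 _; apply: F_restr FS _ _ _ _ Fchi1 _.
  by rewrite -FX2.2 imset_comp Fk.2.
have [h2 [Fh2 h2E]] : cent_ext (chi1 \o (g \o k)).
  by apply: cent_ext_step prQX sXN FX2 _; rewrite (imset_comp chi1) (imset_comp g) kQ gP chi1P.
exists (h1 \o h2); split; first exact (iso_comp FS Fh2 Fh1).
move=> x Px /=; rewrite h2E /=; last by rewrite -chiP imset_f.
by rewrite kK ?(subsetP sPN) // h1E ?hE //= -gP imset_f.
Qed.

End Class.
End Centric.

(** * Saturation from centric subgroups, and saturation class by class *)

Section Saturation.
Variables (gT : finGroupType) (p : nat) (S : {group gT}) (F : fpred gT).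
Hypotheses (pS : p.-group S) (FS : fusion_system S F).
Implicit Types (P Q R X W : {group gT}) (f g : gT -> gT).

(** The group [P] itself is the required member of its class. By [cent_ext_norm], restriction from
    the stabiliser of [P] in [AutF F W] to [AutF F P] is onto, so it sends the Sylow p-subgroup of
    the good pair to one, namely [AutS S P]. For receptivity, an isomorphism [f] onto [P] is an
    embedding [chi] of a normaliser followed by some [h] in [AutF F W]. The good pair extends [h] on
    [P] over its whole extension domain, and [chi] carries the extension domain of [f] into that of
    [h]. *)
Lemma sat_class_self_extended P :
  P \proper S ->
  (forall R, R \subset S -> #|P| < #|R| -> sat_class p S F R) ->
  (forall Q f, iso F Q P f -> #|'N_S(Q)| <= #|'N_S(P)|) ->
  (forall Q Q' f g, iso F Q P g -> iso F Q Q' f -> ext_chain S F Q Q' f) ->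
  good_pair p S F (P <*> 'C_S(P)) P -> pair_norm S (P <*> 'C_S(P)) P = 'N_S(P) ->
  sat_class p S F P.
Proof.
set W := (P <*> 'C_S(P))%G => prPS satP maxP genP gp defN.
have sPS := proper_sub prPS.
have sPW : P \subset W by apply: joing_subl.
have sWS : W \subset S by rewrite join_subG sPS subsetIl.
have sWN : W \subset 'N_S(P).
  by rewrite subsetI sWS join_subG normG cents_norm // subsetIr.
have sPN : P \subset 'N_S(P) by rewrite subsetI sPS normG.
have ext Q f chi : iso F Q P f -> F 'N_S(Q) S chi -> chi @: Q = P ->
    exists h, iso F W W h /\ {in Q, forall x, h (chi x) = f x}.
  move=> Fi Fchi chiQ; apply: (cent_ext_norm pS FS satP maxP genP prPS _ Fchi chiQ).
  exact: (genP _ _ _ _ Fi Fi).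
exists P, id; split; first exact (iso_id FS sPS).
  have [A defA] : exists A : {group {perm gT}}, AutF F W = A.
    by exists (Group (AutF_group_set FS sWS)).
  have [sylT _] := gp; rewrite defA in sylT.
  have sAN : conj_aut W @* pair_norm S W P \subset 'N(P | 'P).
    by rewrite conj_aut_pair_norm ?subsetIr.
  have sylR := morphim_pHall (restr_perm P) sAN sylT.
  have eA : restr_perm P @* (A :&: 'N(P | 'P)) = AutF F P.
    apply/setP=> a; apply/idP/idP.
      case/morphimP=> b Nb /setIP[Ab _] ->; move: Ab; rewrite -defA => /AutFP[Aub Fb].
      apply/AutFP; split; first exact: (Aut_restr_perm sPW).
      apply: (isoE FS (f := b)); last by move=> x Px; rewrite restr_permE.
      apply: (iso_restrE FS Fb.1 sPW); exact: (astabs_setact Nb).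
    (* Surjectivity: with the identity as embedding of [N_S(P)], the extension [h] over [W] agrees
       with [a] on [P]. *)
    case/AutFP=> Aa Fa; have FN : F 'N_S(P) S id by exact (F_incl FS (subsetIl _ _) (subxx S)).
    have [h [Fh hE]] := ext P a id Fa FN (imset_id _).
    have [b Ab bE] := iso_perm FS Fh.
    have bP x : x \in P -> b x = a x by move=> Px; rewrite bE ?hE // (subsetP sPW).
    have Nb : b \in 'N(P | 'P).
      rewrite !inE /=; apply/subsetP=> x Px; rewrite inE /= apermE bP //.
      exact: Aut_mem.
    have -> : a = restr_perm P b.
      have /AutFP[Aub _] := Ab.
      apply: (eq_Aut Aa (Aut_restr_perm sPW Aub)) => x Px.
      by rewrite restr_permE // bP.
    by rewrite mem_morphim // inE -defA Ab.
  rewrite eA in sylR; rewrite /fully_automised.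
  suff <- : restr_perm P @* (conj_aut W @* pair_norm S W P) = AutS S P by [].
  rewrite AutS_conj_aut -defN; apply/setP=> a; apply/idP/idP.
    case/morphimP=> b Nb /morphimP[x NWx Nx eb] ->; rewrite {b}eb in Nb *.
    have NPx : x \in 'N(P) by case/setIP: Nx.
    suff e : restr_perm P (conj_aut W x) = conj_aut P x by rewrite /= e mem_morphim.
    apply: (@eq_Aut _ P); rewrite ?Aut_aut ?(Aut_restr_perm sPW) ?Aut_aut // => y Py.
    by rewrite restr_permE //= !norm_conj_autE // (subsetP sPW).
  case/morphimP=> x NPx Nx ->.
  have NWx : x \in 'N(W) by case/setIP: Nx => /setIP[].
  have Nb : conj_aut W x \in 'N(P | 'P).
    have: conj_aut W x \in conj_aut W @* pair_norm S W P by rewrite mem_morphim.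
    by rewrite conj_aut_pair_norm // => /setIP[].
  suff e : conj_aut P x = restr_perm P (conj_aut W x) by rewrite /= e mem_morphim // mem_morphim.
  apply: (@eq_Aut _ P); rewrite ?Aut_aut ?(Aut_restr_perm sPW) ?Aut_aut // => y Py.
  by rewrite restr_permE //= !norm_conj_autE // (subsetP sPW).
move=> Q f Fi; have Ff := isoFS FS Fi.
have [chi [Fchi chiQ]] := conj_norm_embeds pS FS satP maxP genP Fi.
have [h [Fh hE]] := ext Q f chi Fi Fchi chiQ.
have hP : h @: P = P.
  rewrite -{1}chiQ -imset_comp -[RHS]Fi.2; exact: eq_in_imset.
have FPh : iso F P P h by apply: (iso_restrE FS Fh.1 sPW hP).
have [X eX] : exists X, Nphi S P h = X by exists (Group (Nphi_group_set S FPh)).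
have sXN : X \subset 'N_S(P) by rewrite -eX; apply: Nphi_sub.
have sWX : W \subset X.
  rewrite -eX; apply/subsetP=> w Ww; rewrite inE (subsetP sWN) // hP.
  apply/existsP; exists (h w); rewrite (subsetP sWN) ?(F_mem FS Fh.1) //=.
  by apply/forall_inP=> x Px; rewrite (FJ FS Fh.1) // (subsetP sPW).
have [psi [Fpsi psiE _]] : exists psi, [/\ F X S psi, {in P, psi =1 h} & psi @: W = W].
  apply: (good_pair_extend_cent pS FS gp sPW sPW Fh hP sWX); rewrite defN //.
  move=> x; rewrite -eX inE hP => /andP[_ /existsP[t /andP[Nt /forall_inP tE]]].
  by exists t => // y Py; apply/eqP/tE.
exists (psi \o chi); split; last first.
  by move=> x Qx /=; rewrite psiE ?hE // -chiQ imset_f.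
have [Y eY] : exists Y : {group gT}, Nphi S Q f = Y by exists (Group (Nphi_group_set S Fi)).
have sYN : Y \subset 'N_S(Q) by rewrite -eY; apply: Nphi_sub.
rewrite eY; have [Z [sZ FZ]] := F_iso FS (F_restr FS Fchi sYN).
apply: Fcomp FS _ _ _ _ _ FZ.1 _; apply: (F_restr FS Fpsi).
rewrite -FZ.2 -eX; apply/subsetP=> _ /imsetP[x Yx ->].
have Nx := subsetP sYN x Yx.
have [R [sR FR]] := F_iso FS Fchi.
have sQN : Q \subset 'N_S(Q) by rewrite subsetI normG andbT; have [] := isoS FS Fi.
have Ncx : chi x \in 'N_S(P).
  rewrite inE (F_mem FS Fchi) //= -chiQ.
  by apply: (subsetP (F_norm FS Fchi sYN sQN _)); rewrite ?imset_f // (subset_trans sYN) ?subsetIr.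
rewrite inE Ncx hP; move: Yx; rewrite -eY inE Fi.2 => /andP[_ /existsP[t /andP[Nt /forall_inP tE]]].
apply/existsP; exists t; rewrite Nt; apply/forall_inP=> z; rewrite -chiQ => /imsetP[y Qy ->].
have Qyx : y ^ x \in Q by rewrite memJ_norm //; case/setIP: Nx.
have Ny := subsetP sQN y Qy.
by rewrite -(FJ FS Fchi) // (hE _ Qyx) (hE _ Qy); apply: tE.
Qed.

Lemma sat_class_iso P Q f : iso F P Q f -> sat_class p S F Q -> sat_class p S F P.
Proof.
move=> Fi [R [g [Fg fa rec]]]; exists R, (g \o f); split=> //.
exact (iso_comp FS Fi Fg).
Qed.

(** The group [W = Q C_S(Q)] is larger than [Q], so [(W, Q)] moves to a good pair [(R1, P1)] by a
    map [psi] defined on [N_S(Q)], which normalises [W]. By maximality [psi] maps [N_S(Q)] onto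
    [N_S(P1)], whence [R1 = P1 C_S(P1)], and [sat_class_self_extended] applies to [P1]. *)
Lemma sat_class_noncentric Q :
  (forall R, R \subset S -> #|Q| < #|R| -> sat_class p S F R) ->
  (forall P f, iso F P Q f -> #|'N_S(P)| <= #|'N_S(Q)|) ->
  (forall P P' f g, iso F P Q g -> iso F P P' f -> ext_chain S F P P' f) ->
  Q \subset S -> ~~ ('C_S(Q) \subset Q) -> sat_class p S F Q.
Proof.
move=> satQ maxQ genQ sQS nsCQ.
pose W := (Q <*> 'C_S(Q))%G.
have sWS : W \subset S by rewrite join_subG sQS subsetIl.
have sQW : Q \subset W by apply: joing_subl.
have ltQW : #|Q| < #|W|.
  apply: proper_card; rewrite properE sQW; apply: contra nsCQ.
  by apply: subset_trans; apply: joing_subr.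
have nQW : W \subset 'N(Q) by rewrite join_subG normG cents_norm // subsetIr.
have [R1 [P1 [th [Fth thQ gp]]]] := good_pair_exists pS FS (satQ W sWS ltQW) sQW.
have [_ [psi [_ Fpsi _ [psiW psiQ psiN]]]] := good_pair_norm pS FS gp Fth sQW nQW thQ.
have defN : pair_norm S W Q = 'N_S(Q).
  apply/eqP; rewrite eqEsubset /pair_norm setSI ?subsetIl //= subsetI subsetIr andbT.
  have nQS : 'N_S(Q) \subset 'N(Q) by apply: subsetIr.
  rewrite subsetI subsetIl normsY // normsI ?(subset_trans nQS (cent_norm _)) //.
  by rewrite normsG // subsetIl.
rewrite defN in Fpsi psiN.
have sWN : W \subset 'N_S(Q) by rewrite subsetI sWS.
have sQN := subset_trans sQW sWN.
have FQ : iso F Q P1 psi by apply: (iso_restrE FS Fpsi sQN psiQ).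
have sNN1 : pair_norm S R1 P1 \subset 'N_S(P1) by rewrite subsetI pair_norm_sub subsetIr.
have [N1 [sN1 FN1]] := F_iso FS Fpsi.
have [chi [Fchi chiK Kchi]] := iso_inv FS FN1.
have FP1 : iso F P1 Q chi.
  apply: (iso_restrE FS Fchi.1).
    by rewrite -psiQ -FN1.2 imsetS.
  rewrite -psiQ -imset_comp -[RHS]imset_id; apply: eq_in_imset => x Qx /=.
  by rewrite chiK // (subsetP sQN).
have eN : psi @: 'N_S(Q) = 'N_S(P1).
  apply/eqP; rewrite eqEcard (subset_trans psiN sNN1) FN1.2 (iso_card FS FN1).
  exact: maxQ FP1.
have eNN : pair_norm S R1 P1 = 'N_S(P1).
  by apply/eqP; rewrite eqEsubset sNN1 -eN.
have eN1 : N1 = 'N_S(P1) :> {set gT} by rewrite -eN FN1.2.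
have cardN : #|'N_S(P1)| = #|'N_S(Q)| by rewrite -eN1 (iso_card FS FN1).
have sR1 : R1 \subset S by have [] := isoS FS Fth.
have sP1 : P1 \subset R1 by rewrite -psiQ -psiW imsetS.
have defR1 : R1 = (P1 <*> 'C_S(P1))%G.
  have sC1N : 'C_S(P1) \subset N1 by rewrite eN1 setIS // cent_sub.
  have sP1N : P1 \subset N1 by rewrite -psiQ -FN1.2 imsetS.
  apply/val_inj/eqP; rewrite /= eqEsubset join_subG sP1 /=; apply/andP; split.
    rewrite -psiW; apply/subsetP=> _ /imsetP[w Ww ->].
    have : w \in Q * 'C_S(Q) by rewrite -cent_joinEr // subsetIr.
    case/mulsgP=> q c Qq Cc ->; have Nq := subsetP sQN q Qq.
    have sCN : 'C_S(Q) \subset 'N_S(Q) by rewrite setIS // cent_sub.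
    have Nc := subsetP sCN c Cc.
    rewrite (FM FS Fpsi) // groupM //.
      by rewrite (subsetP (joing_subl _ _)) // -psiQ imset_f.
    rewrite (subsetP (joing_subr _ _)) // inE (F_mem FS Fpsi) // -psiQ.
    by apply: (subsetP (F_cent FS Fpsi sCN sQN (subsetIr _ _))); rewrite imset_f.
  apply/subsetP=> c Cc; have Nc := subsetP sC1N c Cc.
  rewrite -(Kchi c Nc) -psiW imset_f // (subsetP (joing_subr _ _)) // inE.
  rewrite (subsetP _ _ (F_mem FS Fchi.1 Nc)) ?subsetIl //= -FP1.2.
  by apply: (subsetP (F_cent FS Fchi.1 sC1N sP1N (subsetIr _ _))); rewrite imset_f.
rewrite defR1 in gp eNN.
apply: (sat_class_iso FQ); apply: (sat_class_self_extended _ _ _ _ gp eNN).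
- have sP1S : P1 \subset S by rewrite (subset_trans sP1).
  rewrite properEcard sP1S (iso_card FS FQ) (leq_trans ltQW) //.
  exact: subset_leq_card.
- by move=> R sRS; rewrite (iso_card FS FQ); apply: satQ.
- move=> P f Fi; rewrite cardN; apply: (maxQ P (chi \o f)).
  exact (iso_comp FS Fi FP1).
move=> P P' f g Fg; apply: genQ; exact (iso_comp FS Fg FP1).
Qed.

Lemma max_normaliser P : P \subset S -> exists Q f,
  iso F P Q f /\ forall R g, iso F R Q g -> #|'N_S(R)| <= #|'N_S(Q)|.
Proof.
move=> sPS; pose ok Q := pbool (exists f, iso F P Q f).
have okP : ok P by apply/pboolP; exists id; exact (iso_id FS sPS).
case: (@arg_maxnP _ P ok (fun Q => #|'N_S(Q)|) okP) => Q /pboolP[f Fi] maxQ.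
exists Q, f; split=> // R g Fg; apply: maxQ; apply/pboolP.
have [h [Fh _ _]] := iso_inv FS Fg; exists (h \o f).
exact (iso_comp FS Fi Fh).
Qed.

Lemma iso_centric P Q f : iso F P Q f -> centric S F P -> centric S F Q.
Proof.
move=> Fi cP g Fg; have [R [_ FR]] := F_iso FS Fg.
have /cP : F P S (g \o f) by exact (isoFS FS (iso_comp FS Fi FR)).
by rewrite imset_comp Fi.2.
Qed.

(** The embedding sends [C_S(P)] into [C_S(Q)], hence into [Q], the image of [P]; injectivity brings
    this back to [P]. *)
Lemma norm_embeds_cent P Q : norm_embeds S F P Q -> P \subset S ->
  'C_S(Q) \subset Q -> 'C_S(P) \subset P.
Proof.
case=> f [Ff fP] sPS sCQ.
have sCN : 'C_S(P) \subset 'N_S(P) by rewrite setIS // cent_sub.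
have sPN : P \subset 'N_S(P) by rewrite subsetI sPS normG.
apply/subsetP=> c Cc; have Nc := subsetP sCN c Cc.
have : f c \in 'C_S(Q).
  rewrite inE (F_mem FS Ff) //= -fP.
  by apply: (subsetP (F_cent FS Ff sCN sPN (subsetIr _ _))); rewrite imset_f.
move/(subsetP sCQ); rewrite -fP => /imsetP[x Px /(FI FS Ff)-> //].
exact: (subsetP sPN).
Qed.

Lemma centric_self P : P \subset S ->
  (forall Q f, iso F P Q f -> 'C_S(Q) \subset Q) -> centric S F P.
Proof.
move=> sPS h f Ff; have [Q [_ FQ]] := F_iso FS Ff; rewrite FQ.2.
have sQS : Q \subset S by have [] := isoS FS FQ.
by apply/eqP; rewrite eqEsubset {1}/center subsetI (h _ _ FQ) subsetIr /= setSI.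
Qed.

Lemma centric_sub P : P \subset S -> centric S F P -> 'C_S(P) \subset P.
Proof.
move=> sPS /(_ id (F_incl FS sPS (subxx _))); rewrite imset_id => ->.
exact: subsetIl.
Qed.

(** Downward induction on the order. In a noncentric class, a member [Q] with largest normaliser
    cannot contain its centraliser: otherwise the normaliser embeddings into [N_S(Q)] would make
    every conjugate contain its own centraliser, and the class would be centric. *)
Lemma sat_class_of_centric :
  (forall P, P \subset S -> centric S F P -> sat_class p S F P) ->
  (forall P, P \subset S -> ~ centric S F P ->
     forall Q f, iso F P Q f -> ext_chain S F P Q f) ->
  forall P, P \subset S -> sat_class p S F P.
Proof.
move=> satC genN P; have [n] := ubnP (#|S| - #|P|); elim: n P => // n IH P leP sPS.
have [/satC|ncP] := classic (centric S F P); first exact.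
have [Q [f [Fi maxQ]]] := max_normaliser sPS.
have [_ sQS] := isoS FS Fi; have cardQ := iso_card FS Fi.
have satQ R : R \subset S -> #|Q| < #|R| -> sat_class p S F R.
  move=> sRS ltQR; apply: IH => //; rewrite cardQ in ltQR.
  apply: leq_trans (_ : #|S| - #|P| <= n); last by rewrite -ltnS.
  by apply: ltn_sub2l => //; apply: (leq_trans ltQR); exact: subset_leq_card.
have genQ R R' h g : iso F R Q g -> iso F R R' h -> ext_chain S F R R' h.
  move=> Fg Fh; apply: genN (Fh); first by have [] := isoS FS Fg.
  move=> cR; case: ncP; have [k [Fk _ _]] := iso_inv FS Fi.
  exact: iso_centric Fk (iso_centric Fg cR).
apply: (sat_class_iso Fi); apply: sat_class_noncentric => //.
apply/negP=> sCQ; case: ncP; apply: centric_self => // R g Fg.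
have [k [Fk _ _]] := iso_inv FS Fg; have [_ sRS] := isoS FS Fg.
apply: norm_embeds_cent sRS sCQ; apply: (conj_norm_embeds pS FS satQ maxQ genQ).
exact (iso_comp FS Fk Fi).
Qed.

Lemma good_pair_self Q : Q \subset S -> fully_automised p S F Q ->
  receptive S F Q -> good_pair p S F Q Q.
Proof.
move=> sQS fa rec; split=> //.
have -> : AutF F Q :&: 'N(Q | 'P) = AutF F Q.
  apply/setIidPl/subsetP=> a /AutFP[Aa _]; rewrite !inE /=.
  by apply/subsetP=> x Qx; rewrite inE /= apermE Aut_mem.
by rewrite /pair_norm -setIA setIid -AutS_conj_aut.
Qed.

(** The case of equal members in [good_pair_norm]: [(Q, Q)] is a good pair. *)
Lemma automised_norm_embeds P Q f : fully_automised p S F Q -> receptive S F Q ->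
  iso F P Q f -> norm_embeds S F P Q.
Proof.
move=> fa rec Fi; have [sPS sQS] := isoS FS Fi.
have [_ [psi [_ Fpsi _ [psiP _ _]]]] := good_pair_norm pS FS
  (good_pair_self sQS fa rec) Fi (subxx P) (normG P) Fi.2.
by exists psi; rewrite /pair_norm -setIA setIid in Fpsi.
Qed.

Lemma norm_embeds_mem P Q f : P \subset S -> F 'N_S(P) S f -> f @: P = Q ->
  f @: 'N_S(P) \subset 'N_S(Q) /\ f @: 'C_S(P) \subset 'C_S(Q).
Proof.
move=> sPS Ff fP; have [_ _ sfN] := FSub FS Ff.
have sCN : 'C_S(P) \subset 'N_S(P) by rewrite setIS // cent_sub.
have sPN : P \subset 'N_S(P) by rewrite subsetI sPS normG.
rewrite !subsetI sfN (subset_trans (imsetS f sCN) sfN) -fP; split.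
  by rewrite (F_norm FS Ff) // subsetIr.
by rewrite (F_cent FS Ff) // subsetIr.
Qed.

Lemma norm_embeds_card P Q : P \subset S -> norm_embeds S F P Q ->
  #|'C_S(P)| <= #|'C_S(Q)| /\ #|AutS S P| <= #|AutS S Q|.
Proof.
move=> sPS [f [Ff fP]]; have [sN sC] := norm_embeds_mem sPS Ff fP.
have sPN : P \subset 'N_S(P) by rewrite subsetI sPS normG.
have Fi : iso F P Q f by apply: (iso_restrE FS Ff sPN fP).
have sCN : 'C_S(P) \subset 'N_S(P) by rewrite setIS // cent_sub.
split.
  rewrite -(card_in_imset (f := f)) ?subset_leq_card //.
  by move=> x y Cx Cy; apply: (FI FS Ff); apply: (subsetP sCN).
have [tr [injt tA tF trE]] := Aut_transport FS Fi.
have sAA : AutS S P \subset Aut P by rewrite AutS_conj_aut Aut_conj_aut.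
rewrite -(card_injm injt) // subset_leq_card //.
apply/subsetP=> _ /morphimP[a Aa + ->].
rewrite {1}AutS_conj_aut => /morphimP[x NPx Nx ea].
have Nfx : f x \in 'N_S(Q) by apply: (subsetP sN); rewrite imset_f.
have NQfx : f x \in 'N(Q) by case/setIP: Nfx.
have -> : tr a = conj_aut Q (f x).
  apply: (@eq_Aut _ Q); rewrite ?Aut_aut //; first by rewrite -tA mem_morphim.
  move=> z; rewrite -{1}fP => /imsetP[y Py ->].
  rewrite trE // norm_conj_autE //; last by rewrite -fP imset_f.
  by rewrite ea norm_conj_autE // (FJ FS Ff) // (subsetP sPN).
by rewrite AutS_conj_aut mem_morphim.
Qed.

(** All normalisers in a class embed in that of the automised receptive member [Q]. If [P] is fully
    normalised, its embedding is bijective, so the orders of [C_S] and [AutS] agree for [P] and [Q].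
    If [R], the image of [f], is fully centralised, its embedding [psi] maps [C_S(R)] onto [C_S(Q)].
    Receptivity then extends [psi \o f], and following that extension by the inverse of [psi]
    extends [f]. *)
Lemma sat_class_saturated : (forall P, P \subset S -> sat_class p S F P) ->
  saturated p S F.
Proof.
move=> sat; split=> // [P sPS fnP | P f sPS Ff fcP].
  have [Q [f [Fi fa rec]]] := sat P sPS; have [_ sQS] := isoS FS Fi.
  have [psi [Fpsi psiP]] := automised_norm_embeds fa rec Fi.
  have [N1 [sN1 FN1]] := F_iso FS Fpsi.
  have [sN _] := norm_embeds_mem sPS Fpsi psiP.
  have eN : N1 = 'N_S(Q) :> {set gT}.
    apply/eqP; rewrite eqEcard -{1}FN1.2 sN (iso_card FS FN1) -Fi.2.
    by apply: fnP; exact (isoFS FS Fi).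
  have [chi [Fchi chiK _]] := iso_inv FS FN1.
  have embQP : norm_embeds S F Q P.
    exists chi; rewrite -eN; split; first exact (isoFS FS Fchi).
    rewrite -psiP -imset_comp -[RHS]imset_id; apply: eq_in_imset => x Px /=.
    by rewrite chiK // inE (subsetP sPS) // (subsetP (normG P)).
  have [CQP AQP] := norm_embeds_card sQS embQP.
  have [_ APQ] := norm_embeds_card sPS (ex_intro _ psi (conj Fpsi psiP)).
  split.
    move=> g Fg; have [R [_ FR]] := F_iso FS Fg; rewrite FR.2.
    have [k [Fk _ _]] := iso_inv FS FR; have [_ sRS] := isoS FS FR.
    apply: leq_trans CQP.
    have embRQ : norm_embeds S F R Q.
      apply: automised_norm_embeds fa rec _; exact (iso_comp FS Fk Fi).
    by have [] := norm_embeds_card sRS embRQ.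
  have [tr [injt tA tF trE]] := Aut_transport FS Fi.
  have [A eA] : exists A : {group {perm gT}}, AutF F P = A.
    by exists (Group (AutF_group_set FS sPS)).
  have [B eB] : exists B : {group {perm gT}}, AutF F Q = B.
    by exists (Group (AutF_group_set FS sQS)).
  have cardA : #|A| = #|B| by rewrite -eA -eB -tF card_injm // AutF_Aut.
  have cardS : #|AutS S P| = #|AutS S Q| by apply/eqP; rewrite eqn_leq APQ.
  have := AutS_AutF FS sPS.
  rewrite /fully_automised !AutS_conj_aut eA eB in fa cardS * => sA.
  rewrite pHallE sA /= cardS cardA.
  by move: fa; rewrite pHallE => /andP[].
have [R [_ FR]] := F_iso FS Ff; rewrite FR.2 in fcP.
have [_ sRS] := isoS FS FR.
have [Q [g [Fg fa rec]]] := sat R sRS; have [_ sQS] := isoS FS Fg.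
have [psi [Fpsi psiR]] := automised_norm_embeds fa rec Fg.
have [sN sC] := norm_embeds_mem sRS Fpsi psiR.
have sRN : R \subset 'N_S(R) by rewrite subsetI sRS normG.
have sCN : 'C_S(R) \subset 'N_S(R) by rewrite setIS // cent_sub.
have eC : psi @: 'C_S(R) = 'C_S(Q).
  apply/eqP; rewrite eqEcard sC card_in_imset.
    by rewrite -Fg.2; apply: fcP; exact (isoFS FS Fg).
  by move=> x y Cx Cy; apply: (FI FS Fpsi); apply: (subsetP sCN).
have Fpf : iso F P Q (psi \o f).
  by apply: (iso_comp FS FR); apply: (iso_restrE FS Fpsi sRN psiR).
have [om [Fom omE]] := rec P _ Fpf.
have [N eN] : exists N : {group gT}, Nphi S P f = N.
  by exists (Group (Nphi_group_set S FR)).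
have [N' eN'] : exists N' : {group gT}, Nphi S P (psi \o f) = N'.
  by exists (Group (Nphi_group_set S Fpf)).
have NE x : x \in N -> x \in 'N_S(P) /\ exists2 h, h \in 'N_S(R) &
    {in P, forall y, f (y ^ x) = f y ^ h}.
  rewrite -eN => /setIdP[Nx /existsP[h /andP[]]]; rewrite FR.2 => Nh /forall_inP hE.
  by split=> //; exists h => // y Py; apply/eqP/hE.
have sPN : P \subset 'N_S(P) by rewrite subsetI sPS normG.
have ffR y : y \in P -> f y \in 'N_S(R).
  by move=> Py; rewrite (subsetP sRN) // (F_mem FS FR.1).
have sNN' : N \subset N'.
  apply/subsetP=> x /NE[Nx [h Nh hE]]; rewrite -eN' inE Nx Fpf.2.
  apply/existsP; exists (psi h); rewrite (subsetP sN) ?imset_f //=.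
  by apply/forall_inP=> y Py; rewrite hE // (FJ FS Fpsi) ?ffR.
rewrite eN' in Fom.
have sPN' : P \subset N.
  rewrite -eN; apply/subsetP=> x Px; rewrite inE (subsetP sPN) //.
  apply/existsP; exists (f x); rewrite FR.2 ffR //=.
  by apply/forall_inP=> y Py; rewrite (FJ FS Ff).
have [M [sM FM']] := F_iso FS Fpsi.
have [chi [Fchi chiK _]] := iso_inv FS FM'.
(* If [h] realises the action of [x] through [f], then [om x] and [psi h] act alike on [Q]. They
   differ by an element of [C_S(Q)], the image of [C_S(R)] under [psi], so [om x] lies in the image
   of [psi]. *)
have sNM : om @: N \subset M.
  apply/subsetP=> _ /imsetP[x Nx ->]; have [NPx [h Nh hE]] := NE x Nx.
  have N'x := subsetP sNN' x Nx.
  have Cx : om x * (psi h)^-1 \in 'C_S(Q).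
    rewrite inE groupM ?groupV ?(F_mem FS Fom) ?(F_mem FS Fpsi) //=.
    apply/centP=> z; rewrite -Fpf.2 => /imsetP[y Py ->].
    apply/commute_sym/commgP/conjg_fixP; rewrite conjgM.
    have N'y := subsetP sNN' _ (subsetP sPN' y Py).
    have Pyx : y ^ x \in P by rewrite memJ_norm //; case/setIP: NPx.
    rewrite -omE // -(FJ FS Fom) // omE //= hE // (FJ FS Fpsi) ?ffR //.
    by rewrite conjgK omE.
  rewrite -eC in Cx; case/imsetP: Cx => c Cc ec.
  have Nc := subsetP sCN c Cc.
  have -> : om x = psi (c * h) by rewrite (FM FS Fpsi) // -ec mulgKV.
  by rewrite -FM'.2 imset_f // groupM.
exists (chi \o om); split.
  rewrite eN; have [L [sL FL]] := F_iso FS (F_restr FS Fom sNN').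
  apply: (Fcomp FS FL.1); apply: (F_restr FS (isoFS FS Fchi)).
  by rewrite -FL.2.
by move=> y Py /=; rewrite omE //= chiK ?ffR.
Qed.

Lemma saturated_sat_class : saturated p S F ->
  forall P, P \subset S -> sat_class p S F P.
Proof.
case=> _ fnP extP P sPS; have [Q [f [Fi maxQ]]] := max_normaliser sPS.
have [_ sQS] := isoS FS Fi.
have fnQ : fully_normalised S F Q.
  move=> g Fg; have [R [_ FR]] := F_iso FS Fg; have [k [Fk _ _]] := iso_inv FS FR.
  by rewrite FR.2; apply: maxQ Fk.
have [fcQ faQ] := fnP Q sQS fnQ.
exists Q, f; split=> // R g Fg; have [sRS _] := isoS FS Fg.
by apply: extP => //; [exact (isoFS FS Fg) | rewrite Fg.2].
Qed.

End Saturation.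

(** * Alperin's fusion theorem with essential subgroups *)

Lemma p'group_trivial_p_elt (T : finGroupType) (p : nat) (G : {group T}) : prime p ->
  (forall x, x \in G -> p.-elt x -> x = 1) -> p^'.-group G.
Proof.
move=> p_pr triv; rewrite /pgroup p'natE //; apply/negP=> pG.
have [x Gx ox] := Cauchy p_pr pG.
move: (prime_gt1 p_pr); rewrite -ox (triv x Gx) ?order1 //.
by rewrite /p_elt ox pnat_id.
Qed.

(** A test before passing to the quotient: a nontrivial p-element of the intersection of [K / H]
    with a conjugate lifts to a p-element of [K] outside [H], to which [sep] applies. *)
Lemma strongly_embedded_quotient (T : finGroupType) (p : nat) (H K G P : {group T}) :
  prime p -> H <| G -> H \subset K -> K \proper G -> p.-Sylow(G) P -> P \subset K ->
  (forall g x, g \in G -> x \in K -> p.-elt x -> x ^ g \in K -> x \notin H -> g \in K) ->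
  strongly_p_embedded p (K / H) (G / H).
Proof.
move=> p_pr nHG sHK prKG sylP sPK sep.
have [sKG _] := andP prKG; have [sHG nHG'] := andP nHG.
have nHK := subset_trans sKG nHG'.
split; first exact: groupP.
- by rewrite quotient_proper // /normal sHK.
- exists (P / H)%G; last exact: quotientS.
  by apply: quotient_pHall => //; apply: subset_trans (pHall_sub sylP) nHG'.
move=> gb /setDP[/morphimP[g Ng Gg ->] nKg].
apply: p'group_trivial_p_elt => // xb /setIP[/morphimP[z Nz Kz ->]].
case/imsetP=> _ /morphimP[y Ny Ky ->] ez pz.
(* The image of [z] is a p-element, so it is also the image of the p-part of [z]. *)
have ex : coset H z = coset H z.`_p by rewrite morph_constt // (constt_p_elt pz).
have Kx : z.`_p \in K by apply: groupX.
have Nx := subsetP nHK _ Kx.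
have Kxg : z.`_p ^ g^-1 \in K.
  have : coset H (z.`_p ^ g^-1) = coset H y.
    by rewrite morphJ ?groupV //= -ex ez morphV // conjgK.
  have Nxg : z.`_p ^ g^-1 \in 'N(H) by rewrite groupJ ?groupV.
  move/(rcoset_kercosetP Nxg Ny)/rcosetP=> [h Hh ->].
  by rewrite groupM // (subsetP sHK).
have gK : g \notin K by apply: contra nKg => Kg; rewrite mem_quotient.
rewrite [LHS]ex; apply: coset_id.
apply: contraR gK => nHx; rewrite -groupV.
by apply: (sep _ z.`_p); rewrite ?groupV ?p_elt_constt.
Qed.

Section Alperin.
Variables (gT : finGroupType) (p : nat) (S : {group gT}) (F : fpred gT).
Hypotheses (p_pr : prime p) (pS : p.-group S) (FS : fusion_system S F).
Implicit Types (P Q R X W : {group gT}) (f g : gT -> gT).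
Local Notation ext_chain := (ext_chain S F).

Lemma ext_chain_eq P Q f g : {in P, f =1 g} -> ext_chain P Q f -> ext_chain P Q g.
Proof.
move=> fg sf; case: sf fg => [P' f' f'E|P' P1 P2 R k f' h pr Fk kP sf' hE] fg.
  by apply: ExtId => x Px; rewrite -fg ?f'E.
by apply: ExtStep pr Fk kP sf' _ => x Px; rewrite -fg ?hE.
Qed.

Lemma ext_chain_iso P Q f : P \subset S -> ext_chain P Q f -> iso F P Q f.
Proof.
move=> + sf; elim: sf => {P Q f} [P f fE sPS|P P1 P2 R g f h pr Fg gP _ IH hE sPS].
  by apply: (isoE FS (iso_id FS sPS)) => x Px; rewrite fE.
have Fi : iso F P P1 g by apply: (iso_restrE FS Fg (proper_sub pr)).
have [_ sP1] := isoS FS Fi.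
by apply: (isoE FS (iso_comp FS Fi (IH sP1))) => x Px; rewrite hE.
Qed.

Lemma ext_chain_trans P Q R f g : P \subset S ->
  ext_chain P Q f -> ext_chain Q R g -> ext_chain P R (g \o f).
Proof.
move=> + sf; elim: sf R g => {P Q f}.
  by move=> P f fE R g sPS sg; apply: ext_chain_eq sg => x Px /=; rewrite fE.
move=> P P1 P2 X k f h pr Fk kP _ IH hE R g sPS sg.
have [_ sP1] := isoS FS (iso_restrE FS Fk (proper_sub pr) kP).
by apply: ExtStep pr Fk kP (IH R g sP1 sg) _ => x Px /=; rewrite hE.
Qed.

Lemma ext_chain_restr P Q R f : P \proper R -> F R S f -> f @: P = Q -> ext_chain P Q f.
Proof. by move=> pr Ff fP; apply: ExtStep pr Ff fP (@ExtId _ _ _ Q id _) _. Qed.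

Lemma ext_chain_conj P u : P \proper S -> u \in 'N_S(P) -> ext_chain P P (conj_aut P u).
Proof.
move=> prP /setIP[Su Nu].
apply: (@ext_chain_eq _ _ (conjg^~ u)) => [x Px|]; first by rewrite norm_conj_autE.
apply: (ext_chain_restr prP); last exact: (normP Nu).
by have [+ _] := iso_conj FS (subxx S) Su; rewrite conjGid.
Qed.

Lemma norm_embeds_ext_chain P Q : P \proper S -> norm_embeds S F P Q ->
  exists f g, [/\ ext_chain P Q f, ext_chain Q P g, {in P, cancel f g} & {in Q, cancel g f}].
Proof.
move=> prP [f [Ff fP]]; have prN := norm_grow pS (subxx S) prP.
have sPN := proper_sub prN.
have [N [sN FN]] := F_iso FS Ff; have [g [Fg fK gK]] := iso_inv FS FN.
have FP : iso F P Q f by apply: (iso_restrE FS Ff sPN fP).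
have sQN : Q \subset N by rewrite -fP -FN.2 imsetS.
exists f, g; split; first exact: (ext_chain_restr prN Ff fP).
- apply: (ext_chain_restr _ (isoFS FS Fg)).
    by rewrite properEcard sQN (iso_card FS FP) (iso_card FS FN) proper_card.
  rewrite -fP -imset_comp -[RHS]imset_id; apply: eq_in_imset => x Px /=.
  by rewrite fK // (subsetP sPN).
- by move=> x Px; rewrite fK // (subsetP sPN).
by move=> x Qx; rewrite gK // (subsetP sQN).
Qed.

Hypothesis sat : forall P, P \subset S -> sat_class p S F P.

(** Let [Q] be the automised receptive conjugate. If all F-automorphisms of [Q] are chains, so are
    all isomorphisms in the class, since normaliser embeddings into [N_S(Q)] are chains. Otherwise,
    for every conjugate [P1], the automorphisms that are chains form a proper subgroup [K] of
    [AutF F P1], whose image modulo inner automorphisms is strongly p-embedded. *)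
Lemma alperin P : P \proper S ->
  (forall P' f, iso F P P' f -> ext_chain P P' f) \/
  (forall P' f, iso F P P' f -> essential p S F P').
Proof.
move=> prP; have sPS := proper_sub prP.
have [Q [f0 [Fi fa rec]]] := sat sPS; have [_ sQS] := isoS FS Fi.
have emb P1 g : iso F P P1 g -> norm_embeds S F P1 Q.
  move=> Fg; have [k [Fk _ _]] := iso_inv FS Fg.
  by apply: (automised_norm_embeds pS FS fa rec (iso_comp FS Fk Fi)).
have pr P1 g : iso F P P1 g -> P1 \proper S.
  move=> Fg; have [_ sP1] := isoS FS Fg.
  by rewrite properEcard sP1 (iso_card FS Fg) proper_card.
have [allQ|nall] :=
  classic (forall a, a \in AutF F Q -> ext_chain Q Q a).
  left=> P' f Ff; have [_ sP'] := isoS FS Ff.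
  have [e [k [se sk eK kK]]] := norm_embeds_ext_chain prP (emb _ _ (iso_id FS sPS)).
  have [e' [k' [se' sk' eK' kK']]] := norm_embeds_ext_chain (pr _ _ Ff) (emb _ _ Ff).
  have Fq : iso F Q Q (e' \o (f \o k)).
    apply: (iso_comp FS _ (ext_chain_iso sP' se')).
    exact (iso_comp FS (ext_chain_iso sQS sk) Ff).
  have [a Aa aE] := iso_perm FS Fq.
  apply: (@ext_chain_eq _ _ (k' \o (a \o e))).
    move=> x Px /=; have [Fe _] := ext_chain_iso sPS se.
    rewrite aE ?(F_mem FS Fe) //= eK // eK' // (F_mem FS Ff.1) //.
  apply: ext_chain_trans sk' => //; exact: ext_chain_trans (allQ a Aa).
have [a0 Aa0 na0] : exists2 a, a \in AutF F Q & ~ ext_chain Q Q a.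
  apply: NNPP => h; apply: nall => a Aa; apply: NNPP => na.
  by apply: h; exists a.
right=> P1 f1 Ff1.
have [_ sP1S] := isoS FS Ff1; have prP1 := pr _ _ Ff1; have prQ := pr _ _ Fi.
(* Such a [u] belongs to the extension domain of [a] but not to [Q], so receptivity extends [a] to a
   subgroup larger than [Q]. *)
have ext_sgen a u v : a \in AutF F Q -> u \in 'N_S(Q) -> v \in 'N_S(Q) ->
    u \notin Q -> {in Q, forall y, a (y ^ u) = a y ^ v} -> ext_chain Q Q a.
  move=> /AutFP[Aa Fa] Nu Nv nQu auv; have [psi [Fpsi psiE]] := rec _ _ Fa.
  have [X eX] : exists X : {group gT}, Nphi S Q a = X.
    by exists (Group (Nphi_group_set S Fa)).
  rewrite eX in Fpsi; apply: (@ext_chain_eq _ _ psi) => //.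
  apply: (ext_chain_restr _ Fpsi); last by rewrite (eq_in_imset psiE) im_Aut.
  have NX y z : y \in 'N_S(Q) -> z \in 'N_S(Q) ->
      {in Q, forall t, a (t ^ y) = a t ^ z} -> y \in X.
    move=> Ny Nz yz; rewrite -eX inE Ny Fa.2; apply/existsP; exists z.
    by rewrite Nz; apply/forall_inP=> t Qt; rewrite yz.
  have QN y : y \in Q -> y \in 'N_S(Q).
    by move=> Qy; rewrite inE (subsetP sQS) // (subsetP (normG Q)).
  apply/properP; split; last by exists u => //; apply: NX auv.
  apply/subsetP=> y Qy; apply: (NX y (a y)); rewrite ?QN ?Aut_mem // => t Qt.
  by rewrite (AutJ Aa).
(* An element of [C_S(Q)] outside [Q] acts trivially on [Q], so it would make every automorphism of
   [Q] extendable. *)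
have sCQ : 'C_S(Q) \subset Q.
  apply: contra_notT na0 => /subsetPn[c Cc nQc].
  have [Sc cQc] := setIP Cc; apply: (ext_sgen a0 c 1) => //.
    by rewrite inE Sc (subsetP (cent_sub Q)).
  move=> y Qy; rewrite conjg1; congr (a0 _).
  by apply/conjg_fixP/commgP/commute_sym; apply: (centP cQc).
split.
  apply: (centric_self FS sP1S) => P2 f2 Ff2; have [_ sP2] := isoS FS Ff2.
  apply: (norm_embeds_cent FS _ sP2 sCQ); apply: (emb P2 (f2 \o f1)).
  exact (iso_comp FS Ff1 Ff2).
have [e [k [se sk eK kK]]] := norm_embeds_ext_chain prP1 (emb _ _ Ff1).
have Fe := ext_chain_iso sP1S se; have Fk := ext_chain_iso sQS sk.
have [tr [injt tA tF trE]] := Aut_transport FS Fe.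
have [A eA] : exists A : {group {perm gT}}, AutF F P1 = A.
  by exists (Group (AutF_group_set FS sP1S)).
have sAAut : A \subset Aut P1 by rewrite -eA AutF_Aut.
have sgen_tr a : a \in A -> ext_chain P1 P1 a <-> ext_chain Q Q (tr a).
  move=> Aa; have Aua := subsetP sAAut a Aa; split=> sa.
    apply: (@ext_chain_eq _ _ (e \o (a \o k))).
      by move=> z Qz /=; rewrite -trE ?kK // (F_mem FS Fk.1).
    by apply: ext_chain_trans se => //; apply: ext_chain_trans sa.
  apply: (@ext_chain_eq _ _ (k \o (tr a \o e))).
    by move=> z Qz /=; rewrite trE // eK // Aut_mem.
  by apply: ext_chain_trans sk => //; apply: ext_chain_trans sa.
have K_group : group_set [set a in A | pbool (ext_chain P1 P1 a)].
  apply/group_setP; split.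
    by rewrite inE group1; apply/pboolP; apply: ExtId => x _; rewrite perm1.
  move=> a b /setIdP[Aa /pboolP sa] /setIdP[Ab /pboolP sb].
  rewrite inE groupM //=; apply/pboolP.
  by apply: ext_chain_eq (ext_chain_trans sP1S sa sb) => x _; rewrite permM.
pose K := Group K_group.
have sKA : K \subset A by apply/subsetP=> a /setIdP[].
(* [P1] need not be fully automised, so the Sylow p-subgroup is pulled back from [AutS S Q] instead
   of being [AutS S P1]. *)
pose T := (tr @*^-1 (conj_aut Q @* 'N_S(Q)))%G.
have trT : tr @* T = AutS S Q.
  by rewrite AutS_conj_aut morphpreK // tA Aut_conj_aut.
have sylT : p.-Sylow(A) T.
  rewrite -(injm_pHall injt) //; last by rewrite subsetIl.
  by rewrite trT -eA tF.
have sTA := pHall_sub sylT.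
have sTK : T \subset K.
  apply/subsetP=> a Ta; have Aa := subsetP sTA a Ta; rewrite inE Aa.
  apply/pboolP/(sgen_tr a Aa); case/morphpreP: Ta => _ /morphimP[u Nu NSu ->].
  exact: ext_chain_conj.
have sInnA : Inn P1 \subset A by rewrite -eA (Inn_AutF FS).
exists (K / Inn P1)%G; rewrite /OutF eA.
apply: (strongly_embedded_quotient p_pr _ _ _ sylT sTK).
- by rewrite /normal sInnA (subset_trans sAAut) ?Inn_norm.
- apply/subsetP=> a Ia; rewrite inE (subsetP sInnA) //; apply/pboolP.
  have : a \in Inn P1 := Ia; rewrite Inn_conj_aut => /morphimP[u Nu Pu ->].
  by apply: ext_chain_conj => //; rewrite inE (subsetP sP1S).
- rewrite properE sKA; apply/negP=> sAK; case: na0.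
  move: Aa0; rewrite -tF eA => /morphimP[a Aua Aa ->]; apply/(sgen_tr a Aa).
  by have /setIdP[_ /pboolP] := subsetP sAK a Aa.
move=> g x Ag Kx px Kxg nIx.
have sylTK : p.-Sylow(K) T by apply: pHall_subl sylT.
have toT y : y \in K -> p.-elt y -> exists2 c, c \in K & y ^ c \in T.
  move=> Ky py; have sy : <[y]> \subset K by rewrite cycle_subG.
  have [c Kc sc] := Sylow_Jsub sylTK sy py; exists c => //.
  by rewrite (subsetP sc) // memJ_conjg cycle_id.
have [c Kc Tc] := toT x Kx px.
have pxg : p.-elt (x ^ g) by rewrite p_eltJ.
have [d Kd Td] := toT (x ^ g) Kxg pxg.
(* With [x] and [x ^ g] moved into [T] by elements [c] and [d] of [K], it suffices to treat [h],
   which conjugates one element of [T] to another. These are induced by elements [u], [v] of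
   [N_S(Q)], with [u] outside [Q] because [x] is not inner; so [ext_sgen] applies. *)
pose h := c^-1 * g * d.
have [Ac Ad] := (subsetP sKA c Kc, subsetP sKA d Kd).
have Ah : h \in A by rewrite !groupM ?groupV.
have -> : g = c * h * d^-1 by rewrite /h !mulgA mulgV mul1g mulgK.
suff Kh : h \in K by exact: (groupM (groupM Kc Kh) (groupVr Kd)).
rewrite inE Ah; apply/pboolP/(sgen_tr h Ah).
have [/morphpreP[Auy /morphimP[u NQu Nu eu]] Tyh] : x ^ c \in T /\ (x ^ c) ^ h \in T.
  by split=> //; rewrite -conjgM /h !mulgA mulgV mul1g conjgM.
have [Auyh /morphimP[v NQv Nv ev]] := morphpreP Tyh.
have Auh := subsetP sAAut h Ah.
have Ah' : tr h \in AutF F Q by rewrite -tF eA mem_morphim.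
apply: (ext_sgen _ u v) => //.
  apply: contra nIx => Qu.
  have nIc : c \in 'N(Inn P1).
    by apply: (subsetP (Inn_norm P1)); apply: (subsetP sAAut).
  rewrite -(memJ_norm _ nIc) Inn_conj_aut.
  have Pku : k u \in P1 := F_mem FS Fk.1 Qu.
  have NPku := subsetP (normG P1) _ Pku.
  suff -> : x ^ c = conj_aut P1 (k u) by rewrite mem_morphim.
  apply: (@eq_Aut _ P1); rewrite ?Aut_aut // => y Py; rewrite norm_conj_autE //.
  have ey := F_mem FS Fe.1 Py.
  apply: (FI FS Fe.1); rewrite ?memJ_norm ?Aut_mem // -trE // eu norm_conj_autE //.
  by rewrite (FJ FS Fe.1) // kK.
have /AutFP[Autrh _] := Ah'.
move=> z Qz; have <- : conj_aut Q u z = z ^ u by rewrite norm_conj_autE.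
have <- : conj_aut Q v (tr h z) = tr h z ^ v by rewrite norm_conj_autE ?Aut_mem.
by rewrite -eu -ev (morphJ tr Auy Auh) permJ.
Qed.

End Alperin.

(** * Existence of the generated fusion system *)

Section Generated.
Variables (gT : finGroupType) (S : {group gT}).
Implicit Types (P Q R : {group gT}) (A B : {set gT}) (f g : gT -> gT).

(** The largest fusion system on [S]. It ensures that the intersection defining a generated system
    is taken over a nonempty family. *)
Definition inj_system : fpred gT := fun A B f =>
  [/\ group_set A, group_set B, A \subset S, B \subset S & inj_hom A B f].

(* An inverse chosen independently of the fusion system, as the inverse of a
   morphism in an intersection of fusion systems has to lie in all of them. *)
Definition inv_on A f (y : gT) : gT := odflt 1 [pick x in A | f x == y].

Lemma inv_onK A f : {in A &, injective f} -> {in A, cancel f (inv_on A f)}.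
Proof.
move=> fI x Ax; rewrite /inv_on; case: pickP => [z /andP[Az /eqP/fI->] //|].
by move/(_ x); rewrite Ax eqxx.
Qed.

Lemma inj_system_fusion : fusion_system S inj_system.
Proof.
split=> //.
- move=> P Q u sPS sQS Su sPQ; split=> //; try exact: groupP.
  split=> [x y _ _|x y _ _|]; [exact: conjMg | exact: conjg_inj|].
  exact: sPQ.
- move=> A B f g [gA gB sA sB [fM fI sf]] fg; split=> //; split.
  + move=> x y Ax Ay; rewrite -!fg ?fM //.
    by have := @groupM _ (Group gA) x y Ax Ay.
  + by move=> x y Ax Ay; rewrite -!fg //; apply: fI.
  by rewrite -(eq_in_imset fg).
- move=> A B C f g [gA gB sA sB [fM fI sf]] [_ gC _ sC [gM gI sg]].
  have fB x : x \in A -> f x \in B by move=> Ax; rewrite (subsetP sf) ?imset_f.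
  split=> //; split.
  + by move=> x y Ax Ay; rewrite fM // gM ?fB.
  + by move=> x y Ax Ay /gI e; apply: fI => //; apply: e; apply: fB.
  by apply/subsetP=> _ /imsetP[x Ax ->]; rewrite (subsetP sg) ?imset_f ?fB.
move=> A B f [gA gB sA sB [fM fI sf]].
have gfA : group_set (f @: A).
  pose g := @Morphism _ _ (Group gA) f (fun x y => @fM x y).
  have <- : g @* Group gA = f @: A := morphimEdom g.
  exact: groupP.
have fK := inv_onK (fun x y Ax Ay => @fI x y Ax Ay).
have sfS := subset_trans sf sB.
split; first by split.
exists (inv_on A f) => //; split=> //; split.
- move=> _ _ /imsetP[x Ax ->] /imsetP[y Ay ->].
  rewrite -fM // !fK //; by have := @groupM _ (Group gA) x y Ax Ay.
- by move=> _ _ /imsetP[x Ax ->] /imsetP[y Ay ->]; rewrite !fK // => ->.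
by apply/subsetP=> _ /imsetP[_ /imsetP[x Ax ->] ->]; rewrite fK.
Qed.

Lemma gen_fusion_system (C : fpred gT) :
  (forall A B f, C A B f -> inj_system A B f) -> fusion_system S (gen_fusion S C).
Proof.
move=> sC; split.
- by move=> A B f /(_ _ inj_system_fusion sC).
- by move=> P Q u sPS sQS Su sPQ G [_ h _ _ _] _; apply: h.
- move=> A B f g Ff fg G GS sCG; have [_ _ h _ _] := GS.
  exact: h (Ff G GS sCG) fg.
- move=> A B D f g Ff Fg G GS sCG; have [_ _ _ h _] := GS.
  exact: h (Ff G GS sCG) (Fg G GS sCG).
move=> A B f Ff; split.
  by move=> G GS sCG; have [_ _ _ _ h] := GS; case: (h _ _ _ (Ff G GS sCG)).
have [_ _ _ _ [_ fI _]] := Ff _ inj_system_fusion sC.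
have fK := inv_onK (fun x y Ax Ay => @fI x y Ax Ay).
exists (inv_on A f) => // G GS sCG; have [_ _ h3 _ h] := GS.
case: (h _ _ _ (Ff G GS sCG)) => _ [g Gg gK].
by apply: h3 Gg _ => _ /imsetP[x Ax ->]; rewrite gK ?fK.
Qed.

End Generated.

(** * The fusion system generated by F0 and the groups Delta *)

Section Adjoin.
Variables (gT : finGroupType) (p : nat) (S : {group gT}) (F0 : fpred gT).
Variables (m : nat) (Q : 'I_m -> {group gT}).
Variable Delta : forall i : 'I_m, {group coset_of (Inn (Q i))}.
Hypotheses (FS0 : fusion_system S F0) (sQS : forall i, Q i \subset S)
  (sDelta : forall i, Delta i \subset Out (Q i)).
Implicit Types (P R : {group gT}) (f g : gT -> gT).

Local Notation F := (gen_fusion S (fus_gens S F0 Delta)).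

Definition lift_Delta i := (coset (Inn (Q i)) @*^-1 (Delta i))%G.

(** A preimage under [coset] lives a priori in the normaliser of [Inn (Q i)] among all
    permutations. *)
Lemma lift_Delta_Aut i : lift_Delta i \subset Aut (Q i).
Proof.
have nIA : Inn_group (Q i) <| Aut (Q i).
  by rewrite /normal Inn_norm andbT; apply/subsetP=> a /setIdP[].
by rewrite -(quotientGK nIA) morphpreS // sDelta.
Qed.

Lemma lift_DeltaP i a : a \in lift_Delta i -> a \in Aut (Q i) /\ coset (Inn (Q i)) a \in Delta i.
Proof. by move=> Da; split; [apply: (subsetP (lift_Delta_Aut i)) | case/morphpreP: Da]. Qed.

Lemma mem_lift_Delta i a : a \in Aut (Q i) -> coset (Inn (Q i)) a \in Delta i -> a \in lift_Delta i.
Proof. by move=> Aa Da; apply/morphpreP; split=> //; apply: (subsetP (Inn_norm _)). Qed.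

(** An explicit form of the F-isomorphisms. Each link is onto its target, so chains can be
    restricted and inverted. They therefore give a fusion system containing the generators, and
    minimality of F makes every F-isomorphism a chain. *)
Inductive chain : {group gT} -> {group gT} -> (gT -> gT) -> Prop :=
| ChainId P f : {in P, f =1 id} -> chain P P f
| ChainF0 P P1 P2 f g h : iso F0 P P1 f -> chain P1 P2 g -> {in P, h =1 g \o f} ->
    chain P P2 h
| ChainD i a P P1 P2 g h : a \in lift_Delta i -> P \subset Q i -> a @: P = P1 ->
    chain P1 P2 g -> {in P, h =1 g \o a} -> chain P P2 h.

Lemma chain_ext P R f g : {in P, f =1 g} -> chain P R f -> chain P R g.
Proof.
move=> fg cf; case: cf fg => {P R f}.
- by move=> P f fE fg; apply: ChainId => x Px; rewrite -fg ?fE.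
- by move=> P P1 P2 f k h Ff ck hE fg; apply: ChainF0 Ff ck _ => x Px; rewrite -fg ?hE.
move=> i a P P1 P2 k h Da sPQ aP ck hE fg.
by apply: ChainD Da sPQ aP ck _ => x Px; rewrite -fg ?hE.
Qed.

Lemma chain_trans P P1 P2 f g : chain P P1 f -> chain P1 P2 g -> chain P P2 (g \o f).
Proof.
move=> cf; elim: cf P2 g => {P P1 f}.
- by move=> P f fE P2 g; apply: chain_ext => x Px /=; rewrite fE.
- move=> P P1 P2 f k h Ff _ IH hE P3 g cg.
  by apply: ChainF0 Ff (IH _ _ cg) _ => x Px /=; rewrite hE.
move=> i a P P1 P2 k h Da sPQ aP _ IH hE P3 g cg.
by apply: ChainD Da sPQ aP (IH _ _ cg) _ => x Px /=; rewrite hE.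
Qed.

Lemma chain_F0 P R f : iso F0 P R f -> chain P R f.
Proof. by move=> Ff; apply: ChainF0 Ff (@ChainId R id _) _. Qed.

Lemma chain_D i a P R : a \in lift_Delta i -> P \subset Q i -> a @: P = R -> chain P R a.
Proof. by move=> Da sPQ aP; apply: ChainD Da sPQ aP (@ChainId R id _) _. Qed.

Lemma lift_Delta_image i a P : a \in lift_Delta i -> P \subset Q i ->
  exists R, [/\ a @: P = R, R \subset Q i & inj_system S P R a].
Proof.
move=> Da sPQ; have [Aa _] := lift_DeltaP Da.
pose R := (autm Aa @* P)%G; have eR : a @: P = R.
  by rewrite /R /= morphimEsub //= autmE.
exists R; have sRQ : R \subset Q i by rewrite -eR -(im_Aut Aa) imsetS.
split=> //; split; rewrite ?groupP ?(subset_trans _ (sQS i)) //; split.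
- by move=> x y Px Py; rewrite (AutM Aa) ?(subsetP sPQ).
- by move=> x y _ _; apply: perm_inj.
by rewrite eR.
Qed.

Lemma F0_image P R f : iso F0 P R f -> inj_system S P R f.
Proof. by case=> Ff _; case: FS0 => h _ _ _ _; apply: h. Qed.

Lemma chain_inj P R f : P \subset S -> chain P R f -> inj_system S P R f /\ f @: P = R.
Proof.
move=> + cf; have IS := inj_system_fusion S; elim: cf => {P R f}.
- move=> P f fE sPS; rewrite (eq_in_imset fE) imset_id; split=> //.
  by apply: (F_ext IS (F_incl IS (subxx P) sPS)) => x Px; rewrite fE.
- move=> P P1 P2 f k h Ff _ IH hE sPS; have [_ sP1] := isoS FS0 Ff.
  have [Ik kP] := IH sP1; rewrite (eq_in_imset hE) imset_comp Ff.2; split=> //.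
  by apply: (F_ext IS (Fcomp IS (F0_image Ff) Ik)) => x Px; rewrite hE.
move=> i a P P1 P2 k h Da sPQ aP _ IH hE sPS.
have [R [eR sR IR]] := lift_Delta_image Da sPQ.
rewrite aP in eR; rewrite -eR in sR IR.
have [Ik kP] := IH (subset_trans sR (sQS i)).
rewrite (eq_in_imset hE) imset_comp aP; split=> //.
by apply: (F_ext IS (Fcomp IS IR Ik)) => x Px; rewrite hE.
Qed.

Lemma chain_restr P R P1 f : chain P R f -> P1 \subset P ->
  exists R1, R1 \subset R /\ chain P1 R1 f.
Proof.
move=> cf; elim: cf P1 => {P R f}.
- by move=> P f fE P1 sP1; exists P1; split=> //; apply: ChainId => x /(subsetP sP1)/fE.
- move=> P P1 P2 f k h Ff _ IH hE P3 sP3.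
  have [P4 [sP4 F4]] := iso_restr FS0 Ff.1 sP3; have [R1 [sR1 cR]] := IH _ sP4.
  by exists R1; split=> //; apply: ChainF0 F4 cR _ => x /(subsetP sP3)/hE.
move=> i a P P1 P2 k h Da sPQ aP _ IH hE P3 sP3.
have [P4 [eP4 _ _]] := lift_Delta_image Da (subset_trans sP3 sPQ).
have sP4 : P4 \subset P1 by rewrite -eP4 -aP imsetS.
have [R1 [sR1 cR]] := IH _ sP4; exists R1; split=> //.
by apply: ChainD Da (subset_trans sP3 sPQ) eP4 cR _ => x /(subsetP sP3)/hE.
Qed.

Lemma chain_inv P R f : chain P R f -> P \subset S ->
  exists2 g, chain R P g & {in P, cancel f g}.
Proof.
elim=> {P R f}.
- by move=> P f fE sPS; exists id; [apply: ChainId | move=> x Px; rewrite fE].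
- move=> P P1 P2 f k h Ff _ IH hE sPS; have [_ sP1] := isoS FS0 Ff.
  have [k' ck' kK] := IH sP1; have [f' [Ff' fK _]] := iso_inv FS0 Ff.
  exists (f' \o k'); first exact: chain_trans ck' (chain_F0 Ff').
  by move=> x Px; rewrite hE //= kK ?fK // (F_mem FS0 Ff.1).
move=> i a P P1 P2 k h Da sPQ aP _ IH hE sPS.
have [R [eR sR _]] := lift_Delta_image Da sPQ; rewrite aP in eR; rewrite -eR in sR.
have [k' ck' kK] := IH (subset_trans sR (sQS i)).
exists (a^-1 \o k').
  apply: chain_trans ck' (chain_D (groupVr Da) sR _).
  rewrite -aP -imset_comp -[RHS]imset_id; apply: eq_imset => x /=.
  by rewrite permK.
by move=> x Px; rewrite hE //= kK ?permK // -aP imset_f.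
Qed.

Definition chain_system : fpred gT := fun A B f =>
  exists P P1 R, [/\ A = P, B = R, P \subset S, R \subset S & P1 \subset R /\ chain P P1 f].

Lemma chain_system_fusion : fusion_system S chain_system.
Proof.
have IS := inj_system_fusion S.
split.
- move=> A B f [P [P1 [R [-> -> sPS sRS [sP1 cf]]]]].
  have [[_ _ _ _ [fM fI sf]] fP] := chain_inj sPS cf.
  by split; rewrite ?groupP //; split=> //; apply: subset_trans sf sP1.
- move=> P R u sPS sRS Su sPR; exists P, (P :^ u)%G, R; split=> //; split=> //.
  by apply: chain_F0; exact (iso_conj FS0 sPS Su).
- move=> A B f g [P [P1 [R [-> -> sPS sRS [sP1 cf]]]]] fg.
  by exists P, P1, R; split=> //; split=> //; apply: chain_ext cf.
- move=> A B C f g [P [P1 [R [-> -> sPS sRS [sP1 cf]]]]].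
  move=> [R' [P2 [T [/val_inj <- -> _ sTS [sP2 cg]]]]].
  have [P3 [sP3 cg']] := chain_restr cg sP1.
  exists P, P3, T; split=> //; split; first exact: subset_trans sP3 sP2.
  exact: chain_trans cf cg'.
move=> A B f [P [P1 [R [-> _ sPS sRS [sP1 cf]]]]].
have [_ fP] := chain_inj sPS cf; have sP1S := subset_trans sP1 sRS.
rewrite fP; split; first by exists P, P1, P1.
have [g cg gK] := chain_inv cf sPS; exists g => //.
by exists P1, P, P.
Qed.

Lemma fus_gens_inj A B f : fus_gens S F0 Delta A B f -> inj_system S A B f.
Proof.
case=> [[-> [_ Ff]]|[i [-> -> [a Aa [Da ->]]]]].
  by case: FS0 => h _ _ _ _; apply: h.
have [R [eR _ IR]] := lift_Delta_image (mem_lift_Delta Aa Da) (subxx _).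
have eRQ : R = Q i by apply: val_inj; rewrite /= -eR im_Aut.
by rewrite -{2}eRQ.
Qed.

Lemma adjoin_fusion : fusion_system S F.
Proof. exact: gen_fusion_system fus_gens_inj. Qed.

Lemma isoF0 P R f : iso F0 P R f -> iso F P R f.
Proof.
move=> Ff; have [sPS sRS] := isoS FS0 Ff.
have FPS : F P S f.
  by move=> G _ h; apply: h; left; split=> //; split=> //; exact (isoFS FS0 Ff).
exact (iso_restrE adjoin_fusion FPS (subxx P) Ff.2).
Qed.

Lemma isoD i a : a \in lift_Delta i -> iso F (Q i) (Q i) a.
Proof.
move=> Da; have [Aa Ca] := lift_DeltaP Da; split; last exact: im_Aut.
by move=> G _ h; apply: h; right; exists i; split=> //; exists a.
Qed.

Lemma iso_chain P R f : iso F P R f -> chain P R f.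
Proof.
case=> Ff fP; have [|P' [P1 [R' [/val_inj eP _ sP' _ [_ cf]]]]] := Ff _ chain_system_fusion.
  move=> A B g [[-> [sA Fg]]|[i [-> -> [a Aa [Da ->]]]]].
    have [P' eP'] := F_group FS0 Fg; rewrite eP' in Fg sA *.
    have [P1 [sP1 Fi]] := F_iso FS0 Fg.
    by exists P', P1, S; split=> //; split=> //; apply: chain_F0.
  exists (Q i), (Q i), (Q i); split=> //; split=> //.
  by apply: chain_D (subxx _) _; rewrite ?im_Aut // mem_lift_Delta.
rewrite -eP in cf sP'; have [_ eP1] := chain_inj sP' cf.
by have <- : P1 = R by apply: val_inj; rewrite /= -fP.
Qed.

Hypotheses (p_pr : prime p) (pS : p.-group S)
  (sat0 : forall P, P \subset S -> sat_class p S F0 P)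
  (faQ : forall i, fully_automised p S F0 (Q i))
  (recQ : forall i, receptive S F0 (Q i))
  (noconj : forall i j f, i != j -> F0 (Q i) S f -> ~~ (f @: Q i \subset Q j))
  (embQ : forall i, strongly_p_embedded p (OutF F0 (Q i)) (Delta i))
  (cQ : forall i, centric S F (Q i))
  (minQ : forall i R, R \proper Q i -> ~ centric S F R)
  (noess : forall i R, R \proper Q i -> ~ essential p S F0 R).

Lemma AutF0_lift_Delta i : AutF F0 (Q i) \subset lift_Delta i.
Proof.
have [_ prK _ _] := embQ i; have [sKD _] := andP prK.
apply/subsetP=> a Aa; have Aua := subsetP (AutF_Aut _ _) a Aa.
apply: mem_lift_Delta => //; apply: (subsetP sKD); apply: mem_morphim => //.
exact: (subsetP (Inn_norm _)).
Qed.

Lemma F0_between i j f : iso F0 (Q i) (Q j) f -> i = j.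
Proof.
move=> Ff; apply/eqP/negPn/negP=> nij.
by have := noconj nij (isoFS FS0 Ff); rewrite Ff.2 subxx.
Qed.

Lemma lift_Delta_centric i a P : a \in lift_Delta i -> P \subset Q i -> centric S F P ->
  P = Q i.
Proof.
move=> Da sPQ cP; apply: val_inj; apply/eqP; rewrite eqEproper sPQ /=.
by apply/negP=> /minQ.
Qed.

(** Induction along the chain: all groups in it are F-centric, so by minimality of [Q i] a link from
    [lift_Delta i] starts and ends at [Q i]. *)
Lemma centric_iso P R f : iso F P R f -> centric S F P ->
  iso F0 P R f \/ exists i b a c, [/\ iso F0 P (Q i) b, a \in lift_Delta i,
    iso F0 (Q i) R c & {in P, f =1 c \o (a \o b)}].
Proof.
move=> Ff; have [sPS _] := isoS adjoin_fusion Ff.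
move: sPS; have := iso_chain Ff; elim=> {P R f Ff}.
- by move=> P f fE sPS _; left; apply: (isoE FS0 (iso_id FS0 sPS)) => x /fE->.
- move=> P P1 P2 f g h Ff cg IH hE sPS cP; have [_ sP1] := isoS FS0 Ff.
  have cP1 := iso_centric adjoin_fusion (isoF0 Ff) cP.
  have [Fg|[i [b [a [c [Fb Da Fc gE]]]]]] := IH sP1 cP1.
    by left; apply: (isoE FS0 (iso_comp FS0 Ff Fg)) => x /hE->.
  right; exists i, (b \o f), a, c; split=> //; first exact (iso_comp FS0 Ff Fb).
  by move=> x Px; rewrite hE //= gE // (F_mem FS0 Ff.1).
move=> i a P P1 P2 g h Da sPQ aP cg IH hE sPS cP.
have eP := lift_Delta_centric Da sPQ cP; have [Aa _] := lift_DeltaP Da.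
have eP1 : P1 = Q i by apply: val_inj; rewrite /= -aP eP im_Aut.
rewrite {}eP {}eP1 in aP hE IH cP *; right.
have [Fg|[j [b [a' [c [Fb Da' Fc gE]]]]]] := IH (sQS i) cP.
  by exists i, id, a, g; split=> //; exact (iso_id FS0 (sQS i)).
(* Between two successive Delta links stands an F0-isomorphism from [Q i] to [Q j]. This forces
   [i = j], and the isomorphism, an F0-automorphism of [Q i], merges with its neighbours in
   [lift_Delta i]. *)
have eij := F0_between Fb; case: j / eij Fb Da' Fc => Fb Da' Fc.
have [b' Ab' bE] := iso_perm FS0 Fb.
have Db' := subsetP (AutF0_lift_Delta i) b' Ab'.
exists i, id, (a * b' * a'), c; split=> //; first exact (iso_id FS0 (sQS i)).
  by rewrite !groupM.
move=> x Qx; rewrite hE //= gE /=; last by rewrite Aut_mem.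
by rewrite !permM bE // Aut_mem.
Qed.

Lemma AutF_lift_Delta i : AutF F (Q i) = lift_Delta i.
Proof.
have FSF := adjoin_fusion.
apply/eqP; rewrite eqEsubset; apply/andP; split; apply/subsetP=> a; last first.
  move=> Da; apply/AutFP; split; first by have [] := lift_DeltaP Da.
  exact (isoD Da).
case/AutFP=> Aa Fa.
have [F0a|[j [b [a' [c [Fb Da' Fc aE]]]]]] := centric_iso Fa (@cQ i).
  by apply: (subsetP (AutF0_lift_Delta i)); apply/AutFP.
have eij := F0_between Fb; case: j / eij Fb Da' Fc aE => Fb Da' Fc aE.
have [b' Ab' bE] := iso_perm FS0 Fb; have [c' Ac' cE] := iso_perm FS0 Fc.
have [Db' Dc'] := (subsetP (AutF0_lift_Delta i) b' Ab', subsetP (AutF0_lift_Delta i) c' Ac').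
have [[Ab _] [Aa' _]] := (lift_DeltaP Db', lift_DeltaP Da').
have [Ac _] := lift_DeltaP Dc'.
suff -> : a = b' * a' * c' by rewrite !groupM.
apply: (eq_Aut Aa); first by rewrite !groupM.
by move=> x Qx; rewrite !permM aE //= cE ?bE // -?bE // !Aut_mem.
Qed.

(** If [g] were outside, the class of [x ^ g] would lie in the intersection of [OutF F0 (Q i)] with
    its conjugate by [g], a p'-group; being a p-element it would be trivial, and [x] inner. *)
Lemma AutF0_sep i (g x : {perm gT}) : g \in lift_Delta i -> x \in AutF F0 (Q i) -> p.-elt x ->
  x ^ g \in AutF F0 (Q i) -> x \notin Inn (Q i) -> g \in AutF F0 (Q i).
Proof.
move=> Dg Kx px Kxg; apply: contraR => nKg.
have [K eK] : exists K : {group {perm gT}}, AutF F0 (Q i) = K.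
  by exists (Group (AutF_group_set FS0 (sQS i))).
have [_ _ _ sep] := embQ i; rewrite /OutF eK in sep.
have sIK : Inn (Q i) \subset K by rewrite -eK (Inn_AutF FS0).
have sKN : K \subset 'N(Inn (Q i)).
  by rewrite -eK (subset_trans (AutF_Aut _ _)) ?Inn_norm.
have [Ag Cg] := lift_DeltaP Dg; have Ng := subsetP (Inn_norm (Q i)) g Ag.
rewrite eK in Kx Kxg nKg; have Nx := subsetP sKN x Kx.
have nKCg : coset (Inn (Q i)) g \notin K / Inn (Q i).
  apply: contra nKg => /morphimP[k Nk Kk].
  move/(rcoset_kercosetP Ng Nk)/rcosetP=> [h Ih ->].
  by rewrite groupM // (subsetP sIK).
pose KI := [group of K / Inn (Q i) :&: (K / Inn (Q i)) :^ coset (Inn (Q i)) g].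
have := sep (coset (Inn (Q i)) g); rewrite inE nKCg Cg => /(_ isT) p'KI.
have KIx : coset (Inn (Q i)) (x ^ g) \in KI.
  rewrite inE mem_quotient //= morphJ //; apply: imset_f; exact: mem_quotient.
have p'x := @mem_p_elt _ p^' _ KI p'KI KIx.
have px' : p.-elt (coset (Inn (Q i)) (x ^ g)) by rewrite morph_p_elt ?p_eltJ // groupJ.
have : coset (Inn (Q i)) (x ^ g) = 1.
  by apply/eqP; rewrite -order_eq1; apply/eqP; apply: pnat_1 px' p'x.
move/coset_idr; rewrite groupJ // => /(_ isT).
by rewrite memJ_norm.
Qed.

(** [OutF F0 (Q i)] contains a Sylow p-subgroup of [Delta i], so the image of [AutS S (Q i)], Sylow
    in [OutF F0 (Q i)], has the right order; [Inn (Q i)] is a p-group, and orders multiply. *)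
Lemma AutS_Sylow_lift_Delta i : p.-Sylow(lift_Delta i) (AutS S (Q i)).
Proof.
have [K eK] : exists K : {group {perm gT}}, AutF F0 (Q i) = K.
  by exists (Group (AutF_group_set FS0 (sQS i))).
have fa := faQ i; rewrite /fully_automised AutS_conj_aut eK in fa.
rewrite AutS_conj_aut; set T := conj_aut _ @* _ in fa *.
have [_ _ [R sylR sRK] _] := embQ i; rewrite /OutF eK in sRK.
have [_ prK _ _] := embQ i; have [sKD _] := andP prK; rewrite /OutF eK in sKD.
set I := Inn (Q i) in R sylR sRK sKD *.
have sIT : Inn (Q i) \subset T.
  rewrite Inn_conj_aut; apply: morphimS; by rewrite subsetI sQS normG.
have sTK := pHall_sub fa.
have sKN : K \subset 'N(Inn (Q i)).
  by rewrite -eK (subset_trans (AutF_Aut _ _)) ?Inn_norm.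
have sTN := subset_trans sTK sKN.
have sylTq := quotient_pHall sTN fa.
have sylRK := pHall_subl sRK sKD sylR.
have cardTR : #|T / I| = #|R| by rewrite (card_Hall sylTq) (card_Hall sylRK).
have sKDl : K \subset lift_Delta i by rewrite -eK AutF0_lift_Delta.
have sDN : lift_Delta i \subset 'N(I) by apply: subsetIl.
have pI : p.-group I by apply: pgroupS sIT (pHall_pgroup fa).
rewrite pHallE (subset_trans sTK) //=; apply/eqP.
have sID : I \subset lift_Delta i := subset_trans sIT (subset_trans sTK sKDl).
have nID : Inn_group (Q i) <| lift_Delta i by rewrite /normal sID.
have nIT : Inn_group (Q i) <| T by rewrite /normal sIT.
rewrite -(Lagrange sID) -(Lagrange sIT) -!card_quotient //.
rewrite partnM ?cardG_gt0 // part_pnat_id //.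
congr (_ * _)%N.
have -> : lift_Delta i / I = Delta i by apply: cosetpreK.
by rewrite cardTR (card_Hall sylR).
Qed.

Lemma iso_to_Q i R f : iso F R (Q i) f -> exists b a,
  [/\ iso F0 R (Q i) b, a \in lift_Delta i & {in R, f =1 a \o b}].
Proof.
have FSF := adjoin_fusion; move=> Ff; have [k [Fk fK kK]] := iso_inv FSF Ff.
have [a0 [c [Fc Da0 kE]]] : exists a0 c,
    [/\ iso F0 (Q i) R c, a0 \in lift_Delta i & {in Q i, k =1 c \o a0}].
  have [F0k|[j [b [a [c [Fb Da Fc kE]]]]]] := centric_iso Fk (@cQ i).
    by exists 1, k; split=> // x _ /=; rewrite perm1.
  have eij := F0_between Fb; case: j / eij Fb Da Fc kE => Fb Da Fc kE.
  have [b' Ab' bE] := iso_perm FS0 Fb.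
  have Db' := subsetP (AutF0_lift_Delta i) b' Ab'.
  exists (b' * a), c; split; rewrite ?groupM // => x Qx.
  by rewrite kE //= permM bE.
have [d [Fd cK dK]] := iso_inv FS0 Fc.
exists d, a0^-1; split; rewrite ?groupV // => x Rx /=.
have Qfx := F_mem FSF Ff.1 Rx.
apply: (canRL (permK a0)).
have [Aa0 _] := lift_DeltaP Da0.
by rewrite -[in RHS](fK x Rx) kE //= cK // Aut_mem.
Qed.

(** Write [f] as [a \o b] with [b] in F0 and [a] in [lift_Delta i]. An element [u] of the extension
    domain outside [R] gives a noninner p-element of [AutF F0 (Q i)] whose conjugate by [a] is again
    in [AutF F0 (Q i)]. By [AutF0_sep], [a] and hence [f] belong to F0, where [Q i] is receptive. *)
Lemma receptive_Q i : receptive S F (Q i).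
Proof.
have FSF := adjoin_fusion.
move=> R f Ff; have [sRS _] := isoS FSF Ff.
have [k [Fk _ _]] := iso_inv FSF Ff.
have cR := iso_centric FSF Fk (@cQ i).
have [N eN] : exists N : {group gT}, Nphi S R f = N.
  by exists (Group (Nphi_group_set S Ff)).
have [sNR|/subsetPn[u Nu nRu]] := boolP (N \subset R).
  by exists f; split=> //; rewrite eN; apply: (F_restr FSF (isoFS FSF Ff)).
have [b [a [Fb Da fE]]] := iso_to_Q Ff.
suff Aa : a \in AutF F0 (Q i).
  have /AutFP[_ Fa] := Aa.
  have F0f : iso F0 R (Q i) f.
    by apply: (isoE FS0 (iso_comp FS0 Fb Fa)) => x Rx; rewrite fE.
  have [psi [Fpsi psiE]] := recQ F0f; exists psi; split=> //.
  by move=> G _; apply; left; split=> //; split=> //; have [] := FSub FS0 Fpsi.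
move: Nu; rewrite -eN inE => /andP[NSu /existsP[v /andP[]]]; rewrite Ff.2.
move=> NSv /forall_inP uv; have [Su NRu] := setIP NSu; have [Sv NQv] := setIP NSv.
have [tr [injt tA tF trE]] := Aut_transport FS0 Fb.
have [Aua _] := lift_DeltaP Da.
have Aux : tr (conj_aut R u) \in Aut (Q i) by rewrite -tA mem_morphim ?Aut_aut.
apply: (AutF0_sep Da (x := tr (conj_aut R u))).
- rewrite -tF mem_morphim ?Aut_aut // (subsetP (AutS_AutF FS0 sRS)) //.
  by rewrite AutS_conj_aut mem_morphim.
- by rewrite morph_p_elt ?Aut_aut // morph_p_elt //; apply: mem_p_elt pS Su.
- have -> : tr (conj_aut R u) ^ a = conj_aut (Q i) v.
    apply: (@eq_Aut _ (Q i)); rewrite ?Aut_aut ?groupJ // => z.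
    rewrite -{1}Ff.2 => /imsetP[y Ry ->].
    rewrite norm_conj_autE ?(F_mem FSF Ff.1) // -(eqP (uv y Ry)).
    rewrite !fE ?memJ_norm //= permJ trE ?Aut_aut //.
    by rewrite norm_conj_autE.
  by rewrite (subsetP (AutS_AutF FS0 (sQS i))) // AutS_conj_aut mem_morphim.
(* If the transported action of [u] were inner, then [u] would lie in [R C_S(R)], which is [R]
   because [R] is F-centric. *)
rewrite Inn_conj_aut; apply: contra nRu => /morphimP[w Nw Qw ew].
have [r Rr er] : exists2 r, r \in R & w = b r.
  by move: Qw; rewrite -Fb.2 => /imsetP[r Rr ->]; exists r.
have : u * r^-1 \in 'C_S(R).
  apply/setIP; split; first by rewrite groupM // groupV (subsetP sRS).
  apply/centP=> y Ry.
  apply/commute_sym/commgP/conjg_fixP; rewrite conjgM.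
  suff -> : y ^ u = y ^ r by rewrite conjgK.
  have Ryu : y ^ u \in R by rewrite memJ_norm.
  apply: (FI FS0 Fb.1 Ryu (groupJ Ry Rr)); rewrite (FJ FS0 Fb.1 Ry Rr) -er.
  rewrite -(norm_conj_autE NRu Ry) -trE ?Aut_aut // ew.
  by rewrite norm_conj_autE // (F_mem FS0 Fb.1).
by move/(subsetP (centric_sub FSF sRS cR)); rewrite groupMr // groupV.
Qed.

(** Either [P] is F0-conjugate to some [Q i], or no Delta link can occur and the class has the same
    isomorphisms in F as in F0. *)
Lemma sat_class_of_F_centric P : P \subset S -> centric S F P -> sat_class p S F P.
Proof.
have FSF := adjoin_fusion; move=> sPS cP.
have [[i [b Fb]]|nPQ] := classic (exists i b, iso F0 P (Q i) b).
  apply: (sat_class_iso FSF (isoF0 Fb)).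
  exists (Q i), id; split; first exact (iso_id FSF (sQS i)).
    by rewrite /fully_automised AutF_lift_Delta AutS_Sylow_lift_Delta.
  exact: receptive_Q.
have F_F0 R (T : {group gT}) h f : iso F0 P R h -> iso F R T f -> iso F0 R T f.
  move=> Fh Ff; have cR := iso_centric FSF (isoF0 Fh) cP.
  have [//|[i [b [a [c [Fb _ _ _]]]]]] := centric_iso Ff cR.
  by case: nPQ; exists i, (b \o h); exact (iso_comp FS0 Fh Fb).
have [R [g [Fg fa rec]]] := sat0 sPS; have [_ sRS] := isoS FS0 Fg.
exists R, g; split; first exact (isoF0 Fg).
  suff -> : fully_automised p S F R = fully_automised p S F0 R by [].
  rewrite /fully_automised; congr (is_true (pHall _ _ _)).
  apply/setP=> a; apply/AutFP/AutFP=> -[Aa Fa]; split=> //; first exact: F_F0 Fg Fa.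
  exact (isoF0 Fa).
move=> T f Ff; have [k [Fk _ kK]] := iso_inv FSF Ff.
have F0k := F_F0 _ _ _ _ Fg Fk; have [h [Fh _ hK]] := iso_inv FS0 F0k.
have F0f : iso F0 T R f.
  apply: (isoE FS0 Fh) => x Tx.
  by rewrite -[in RHS](hK x Tx) kK // (F_mem FS0 Fh.1).
have [psi [Fpsi psiE]] := rec _ _ F0f; exists psi; split=> //.
by move=> G _; apply; left; split=> //; split=> //; have [] := FSub FS0 Fpsi.
Qed.

(** Suppose that [P] is not F-centric and follow a chain from [P]. A Delta link would start at some
    [Q i], which is F-centric, or at a proper subgroup of it, which cannot be F0-essential. So all
    F-conjugates of [P] are F0-conjugates, and these contain their centralisers, a contradiction. *)
Lemma all_essential_centric P : P \subset S ->
  (forall R f, iso F0 P R f -> essential p S F0 R) -> centric S F P.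
Proof.
have FSF := adjoin_fusion; move=> sPS ess; apply: NNPP => ncP; apply: (ncP).
apply: (centric_self FSF sPS) => R f Ff.
suff [g Fg] : exists g, iso F0 P R g.
  have [_ sRS] := isoS FS0 Fg; have [cR _] := ess R g Fg.
  exact (centric_sub FS0 sRS cR).
have sX : exists g, iso F0 P P g by exists id; exact (iso_id FS0 sPS).
suff track X Y h : chain X Y h -> (exists g, iso F0 P X g) -> ~ centric S F X ->
    exists g, iso F0 P Y g by exact: (track _ _ _ (iso_chain Ff) sX ncP).
elim=> {X Y h} //.
- move=> X P1 P2 {}f g h {}Ff _ IH hE [k Fk] ncX; apply: IH.
    by exists (f \o k); exact (iso_comp FS0 Fk Ff).
  move=> cP1; case: ncX; have [l [Fl _ _]] := iso_inv FS0 Ff.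
  exact (iso_centric FSF (isoF0 Fl) cP1).
move=> i a X P1 P2 g h Da sXQ aX _ IH hE [k Fk] ncX.
have [eX|prX] := eqVproper sXQ.
  by case: ncX; rewrite (val_inj eX : X = Q i); exact: (@cQ i).
by case: (noess prX); exact: (ess _ _ Fk).
Qed.

Lemma ext_chain_F0 P R f : ext_chain S F0 P R f -> ext_chain S F P R f.
Proof.
elim=> {P R f} [P f fE|P P1 P2 R g f h pr Fg gP _ IH hE]; first exact: ExtId.
apply: ExtStep pr _ gP IH hE => G _; apply; left; split=> //; split=> //.
by have [] := FSub FS0 Fg.
Qed.

(** F0-links split by [alperin], whose second alternative would make [P] F-centric. A Delta link
    starts at a proper subgroup of [Q i], so the automorphism of [Q i] is itself the extension. *)
Lemma ext_chain_noncentric P R f : P \subset S -> ~ centric S F P -> iso F P R f ->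
  ext_chain S F P R f.
Proof.
have FSF := adjoin_fusion; move=> + + Ff; have := iso_chain Ff; elim=> {P R f Ff}.
- by move=> P f fE _ _; apply: ExtId.
- move=> P P1 P2 f g h Ff _ IH hE sPS ncP; have [_ sP1] := isoS FS0 Ff.
  have ncP1 : ~ centric S F P1.
    move=> cP1; case: ncP; have [l [Fl _ _]] := iso_inv FS0 Ff.
    exact (iso_centric FSF (isoF0 Fl) cP1).
  (* [S] is its own only F-conjugate, hence F-centric. *)
  have prP : P \proper S.
    rewrite properEneq sPS andbT; apply/eqP=> eP; apply: ncP.
    apply: (centric_self FSF sPS) => R k Fk; rewrite subIset //.
    have [_ sRS] := isoS FSF Fk.
    suff -> : R = S :> {set gT} by rewrite subxx.
    by apply/eqP; rewrite eqEcard sRS (iso_card FSF Fk) eP leqnn.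
  have [sg|ess] := alperin p_pr pS FS0 sat0 prP.
    apply: (ext_chain_eq (f := g \o f)) => [x /hE->//|].
    apply: (ext_chain_trans FSF sPS) (IH sP1 ncP1).
    by apply: ext_chain_F0; apply: sg.
  by case: ncP; apply: all_essential_centric.
move=> i a P P1 P2 g h Da sPQ aP _ IH hE sPS ncP.
have prP : P \proper Q i.
  rewrite properEneq sPQ andbT; apply/eqP=> eP; case: ncP.
  by rewrite (val_inj eP : P = Q i); exact: (@cQ i).
have Fa := iso_restrE FSF (isoD Da).1 sPQ aP; have [_ sP1] := isoS FSF Fa.
apply: ExtStep prP (isoFS FSF (isoD Da)) aP (IH sP1 _) hE.
move=> cP1; case: ncP; have [l [Fl _ _]] := iso_inv FSF Fa.
exact (iso_centric FSF Fl cP1).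
Qed.

End Adjoin.

Theorem theoremC (gT : finGroupType) (p : nat) (S : {group gT})
    (F0 : fpred gT) (m : nat) (Q : 'I_m -> {group gT})
    (Delta : forall i : 'I_m, {group coset_of (Inn (Q i))}) :
  prime p -> p.-group S -> saturated p S F0 ->
  (forall i, Q i \subset S) ->
  (forall i, fully_normalised S F0 (Q i)) ->
  (forall i j f, i != j -> F0 (Q i) S f -> ~~ (f @: Q i \subset Q j)) ->
  (forall i, Delta i \subset Out (Q i)) ->
  (forall i, strongly_p_embedded p (OutF F0 (Q i)) (Delta i)) ->
  (forall i, centric S F0 (Q i)) ->
  (forall i, centric S (gen_fusion S (fus_gens S F0 Delta)) (Q i) /\
     forall R : {group gT}, R \proper Q i ->
       ~ centric S (gen_fusion S (fus_gens S F0 Delta)) R) ->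
  (forall i (R : {group gT}), R \proper Q i -> ~ essential p S F0 R) ->
  saturated p S (gen_fusion S (fus_gens S F0 Delta)).
Proof.
move=> p_pr pS satF0 sQS fnQ noconj sDelta embQ _ cmQ noess.
have [FS0 fnP extP] := satF0.
have sat0 := saturated_sat_class FS0 satF0.
have FSF := adjoin_fusion FS0 sQS sDelta.
have cQ i : centric S (gen_fusion S (fus_gens S F0 Delta)) (Q i) by have [] := cmQ i.
have minQ i := (cmQ i).2.
have faQ i : fully_automised p S F0 (Q i) by have [] := fnP _ (sQS i) (fnQ i).
have recQ i : receptive S F0 (Q i).
  have [fcQ _] := fnP _ (sQS i) (fnQ i).
  move=> R f Ff; have [sRS _] := isoS FS0 Ff.
  by apply: extP => //; [exact (isoFS FS0 Ff) | rewrite Ff.2].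
apply: (sat_class_saturated pS FSF); apply: (sat_class_of_centric pS FSF).
  move=> P; exact: (@sat_class_of_F_centric gT p S F0 m Q Delta).
move=> P sPS ncP R f Ff; exact: (@ext_chain_noncentric gT p S F0 m Q Delta).
Qed.
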